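(* Let $\mathcal{H}$ be a nonzero complex Hilbert space, let $A\in\mathcal{B}(\mathcal{H})$, and let $f$ be a non-negative increasing operator convex function on $[0,\infty)$. Then for all $\alpha\in[0,1]$, $$f(w^2(A))\le\left\|\int_0^1 f\left((1-t)\left(\alpha\left(\frac{|A|+|A^*|}{2}\right)^2+(1-\alpha)|A|^2\right)+t\,w^2(A)I\right)dt\right\|\le\left\|f\left(\alpha\left(\frac{|A|+|A^*|}{2}\right)^2+(1-\alpha)|A|^2\right)\right\|.$$
   Context: $\mathcal{B}(\mathcal{H})$ is the set of bounded linear operators on $\mathcal{H}$, $A^*$ is the adjoint of $A$, $|A|=(A^*A)^{1/2}$, $I$ is the identity operator, and $\|\cdot\|$ is the operator norm. The numerical radius is $w(A)=\sup\{|\langle Ax,x\rangle| : x\in\mathcal{H},\ \|x\|=1\}$, and $w^2(A)=(w(A))^2$. A real-valued continuous function $f$ on an interval $J$ is operator convex if for all selfadjoint operators $S,T\in\mathcal{B}(\mathcal{H})$ with spectra contained in $J$ one has $f((1-t)S+tT)\le(1-t)f(S)+tf(T)$ for all $t\in[0,1]$, where $f$ of a selfadjoint operator is given by the continuous functional calculus and $\le$ is the usual order on selfadjoint operators. The integral is the integral over $[0,1]$ of a norm-continuous operator-valued function. *)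

(* Defs.v *)
From Stdlib Require Import Reals Lra ssreflect.
From Stdlib Require Import ClassicalEpsilon FunctionalExtensionality
  PropExtensionality ProofIrrelevance.
From Coquelicot Require Import Coquelicot.
Set Implicit Arguments.
Unset Strict Implicit.
Unset Printing Implicit Defensive.
Open Scope R_scope.

(** * Complex Hilbert spaces *)

(** The inner product is linear in its first argument.  Positivity and
    definiteness come from [inner_norm] and the axioms of a norm. *)
Record HilbertSpace := {
  hilbert_sort :> CompleteNormedModule C_AbsRing;
  inner : hilbert_sort -> hilbert_sort -> C;
  inner_plus_l : forall x y z, inner (plus x y) z = Cplus (inner x z) (inner y z);
  inner_scal_l : forall (a : C) x y, inner (scal a x) y = Cmult a (inner x y);
  inner_conj : forall x y, inner y x = Cconj (inner x y);
  inner_norm : forall x, inner x x = RtoC (norm x ^ 2)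
}.

(** * Bounded operators *)

(** Boundedness is part of Coquelicot's [is_linear]. *)
Record Op (H : HilbertSpace) := MkOp {
  op_fun :> H -> H;
  op_linear : is_linear op_fun
}.

Section OpAlgebra.

Context {H : HilbertSpace}.
Implicit Types (A B D : Op H) (x y : H).

Lemma op_ext A B : (forall x, A x = B x) -> A = B.
Proof.
case: A => a ha; case: B => b hb /= e.
have e' : a = b by apply: functional_extensionality.
by subst b; rewrite (proof_irrelevance _ ha hb).
Qed.

Lemma is_linear_sum (f g : H -> H) :
  is_linear f -> is_linear g -> is_linear (fun x => plus (f x) (g x)).
Proof.
move=> hf hg.
exact: (is_linear_comp (fun x => (f x, g x)) _ (is_linear_prod f g hf hg) is_linear_plus).
Qed.

Lemma is_linear_scalar (z : C) : is_linear (fun x : H => scal z x).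
Proof. by apply: is_linear_scal_r => n m; exact: Cmult_comm. Qed.

Definition op_zero : Op H := MkOp (is_linear_zero (U := H) (V := H)).
Definition op_plus A B : Op H := MkOp (is_linear_sum (op_linear A) (op_linear B)).
Definition op_opp A : Op H := MkOp (is_linear_comp A opp (op_linear A) is_linear_opp).
Definition op_mult A B : Op H := MkOp (is_linear_comp B A (op_linear B) (op_linear A)).
Definition op_scalar (z : C) : Op H := MkOp (is_linear_scalar z).
Definition op_one : Op H := MkOp (is_linear_id (V := H)).
Definition op_scal (r : R) A : Op H := op_mult (op_scalar (RtoC r)) A.

Definition Op_AbelianMonoid_mixin : AbelianMonoid.mixin_of (Op H).
Proof.
apply: (AbelianMonoid.Mixin _ op_plus op_zero) => [x y|x y z|x];
  apply: op_ext => u /=.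
- exact: plus_comm.
- exact: plus_assoc.
- exact: plus_zero_r.
Defined.

Canonical Op_AbelianMonoid := AbelianMonoid.Pack (Op H) Op_AbelianMonoid_mixin (Op H).

Definition Op_AbelianGroup_mixin : AbelianGroup.mixin_of Op_AbelianMonoid.
Proof.
apply: (AbelianGroup.Mixin _ op_opp) => x; apply: op_ext => u /=.
exact: plus_opp_r.
Defined.

Canonical Op_AbelianGroup :=
  AbelianGroup.Pack (Op H) (AbelianGroup.Class _ _ Op_AbelianGroup_mixin) (Op H).

Definition Op_Ring_mixin : Ring.mixin_of Op_AbelianGroup.
Proof.
apply: (Ring.Mixin _ op_mult op_one) => [x y z|x|x|x y z|x y z];
  apply: op_ext => u //=.
exact: (linear_plus _ (op_linear x)).
Defined.

Canonical Op_Ring := Ring.Pack (Op H) (Ring.Class _ _ Op_Ring_mixin) (Op H).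

Definition Op_ModuleSpace_mixin : ModuleSpace.mixin_of R_Ring Op_AbelianGroup.
Proof.
apply: (ModuleSpace.Mixin _ _ op_scal) => [r s A|A|r A B|r s A];
  apply: op_ext => u /=.
- by rewrite scal_assoc; congr (scal _ _); rewrite /mult /= RtoC_mult.
- exact: scal_one.
- exact: scal_distr_l.
- by rewrite /plus /= RtoC_plus; exact: (@scal_distr_r C_Ring).
Defined.

Canonical Op_ModuleSpace :=
  ModuleSpace.Pack R_Ring (Op H) (ModuleSpace.Class _ _ _ Op_ModuleSpace_mixin) (Op H).

(** The supremum over the closed unit ball also covers the zero space. *)
Definition op_norm A : R :=
  real (Lub_Rbar (fun r => exists x, norm x <= 1 /\ r = norm (A x))).

Lemma op_norm_sup A :
  (forall x, norm x <= 1 -> norm (A x) <= op_norm A) /\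
  (forall M, (forall x, norm x <= 1 -> norm (A x) <= M) -> op_norm A <= M).
Proof.
rewrite /op_norm.
case: (Lub_Rbar_correct (fun r => exists x, norm x <= 1 /\ r = norm (A x))).
set L := Lub_Rbar _ => ub lub.
have [K [K0 hK]] := linear_norm _ (op_linear A).
have bK : Rbar_le L K.
  apply: lub => r [x [hx ->]] /=; have := hK x.
  have := norm_ge_0 x => h0 h1; apply: Rle_trans h1 _.
  rewrite -[X in _ <= X]Rmult_1_r; apply: Rmult_le_compat_l; lra.
have b0 : Rbar_le (norm (A zero)) L.
  by apply: ub; exists zero; split => //; rewrite norm_zero; lra.
move: bK b0 ub lub; case: L => [l| |] //= bK b0 ub lub; split.
- by move=> x hx; apply: ub; exists x.
- by move=> M hM; apply: (lub (Finite M)) => r [x [hx ->]]; exact: hM.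
Qed.

Lemma op_norm_ge0 A : 0 <= op_norm A.
Proof.
apply: Rle_trans (proj1 (op_norm_sup A) zero _); first exact: norm_ge_0.
by rewrite norm_zero; lra.
Qed.

Lemma op_norm_bound A x : norm (A x) <= op_norm A * norm x.
Proof.
case: (Req_dec (norm x) 0) => [nx0|nx0].
  rewrite (norm_eq_zero x nx0) (linear_zero _ (op_linear A)) !norm_zero; lra.
have nx : 0 < norm x by have := norm_ge_0 x; lra.
have sc (c : R) (y : H) : 0 <= c -> norm (scal (RtoC c) y) <= c * norm y.
  move=> c0; apply: Rle_trans (norm_scal _ _) _.
  by rewrite /abs /= Cmod_R Rabs_pos_eq //; lra.
have ic : 0 < / norm x by exact: Rinv_0_lt_compat.
pose y := scal (RtoC (/ norm x)) x.
have ny : norm y <= 1.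
  apply: Rle_trans (sc _ _ _) _; first lra.
  by rewrite Rinv_l //; lra.
have xE : x = scal (RtoC (norm x)) y.
  rewrite /y scal_assoc /mult /= -RtoC_mult Rinv_r //.
  by rewrite (scal_one (K := C_Ring)).
rewrite {1}xE (linear_scal _ (op_linear A)).
apply: Rle_trans (sc _ _ _) _; first lra.
rewrite Rmult_comm; apply: Rmult_le_compat_r; first lra.
exact: (proj1 (op_norm_sup A)).
Qed.

Lemma op_norm_le A M :
  0 <= M -> (forall x, norm (A x) <= M * norm x) -> op_norm A <= M.
Proof.
move=> M0 hM; apply: (proj2 (op_norm_sup A)) => x hx.
apply: Rle_trans (hM x) _; rewrite -[X in _ <= X]Rmult_1_r.
exact: Rmult_le_compat_l.
Qed.

Lemma op_norm_triangle A B : op_norm (plus A B) <= op_norm A + op_norm B.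
Proof.
apply: op_norm_le => [|x].
  have := op_norm_ge0 A; have := op_norm_ge0 B; lra.
apply: Rle_trans (norm_triangle _ _) _.
have := op_norm_bound A x; have := op_norm_bound B x; lra.
Qed.

Lemma op_norm_scal (r : R) A : op_norm (scal r A) <= Rabs r * op_norm A.
Proof.
apply: op_norm_le => [|x].
  apply: Rmult_le_pos; [exact: Rabs_pos | exact: op_norm_ge0].
apply: Rle_trans (norm_scal _ _) _.
rewrite /abs /= Cmod_R Rmult_assoc.
by apply: Rmult_le_compat_l; [exact: Rabs_pos | exact: op_norm_bound].
Qed.

Lemma op_norm_opp A : op_norm (opp A) = op_norm A.
Proof.
by congr real; apply: Lub_Rbar_eqset => r; split=> -[x [hx ->]]; exists x;
  rewrite /= norm_opp.
Qed.

Lemma op_norm_eq0 A : op_norm A = 0 -> A = zero.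
Proof.
move=> A0; apply: op_ext => x /=; apply: norm_eq_zero.
have := op_norm_bound A x; have := norm_ge_0 (A x); rewrite A0; lra.
Qed.

Definition op_ball A (e : R) B : Prop := op_norm (minus B A) < e.

Lemma op_norm_minus_sym A B : op_norm (minus A B) = op_norm (minus B A).
Proof. by rewrite -op_norm_opp opp_minus. Qed.

Definition Op_UniformSpace_mixin : UniformSpace.mixin_of (Op H).
Proof.
apply: (UniformSpace.Mixin _ zero op_ball); rewrite /op_ball.
- move=> A e; rewrite minus_eq_zero.
  apply: Rle_lt_trans (cond_pos e); apply: op_norm_le; first lra.
  by move=> x /=; rewrite norm_zero; lra.
- by move=> A B e; rewrite op_norm_minus_sym.
- move=> A B D e1 e2 h1 h2.
  rewrite (minus_trans B); apply: Rle_lt_trans (op_norm_triangle _ _) _; lra.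
Defined.

Canonical Op_UniformSpace := UniformSpace.Pack (Op H) Op_UniformSpace_mixin (Op H).

Canonical Op_NormedModuleAux :=
  NormedModuleAux.Pack R_AbsRing (Op H)
    (NormedModuleAux.Class R_AbsRing _ (ModuleSpace.class _ Op_ModuleSpace)
       Op_UniformSpace_mixin) (Op H).

Definition Op_NormedModule_mixin : NormedModule.mixin_of R_AbsRing Op_NormedModuleAux.
Proof.
apply: (NormedModule.Mixin _ _ op_norm 1).
- exact: op_norm_triangle.
- exact: op_norm_scal.
- by [].
- by move=> A B e h; rewrite Rmult_1_l.
- exact: op_norm_eq0.
Defined.

Canonical Op_NormedModule :=
  NormedModule.Pack R_AbsRing (Op H)
    (NormedModule.Class _ _ _ Op_NormedModule_mixin) (Op H).

Section Completeness.

Variable F : (Op H -> Prop) -> Prop.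
Hypothesis FF : ProperFilter F.
Hypothesis cF : cauchy F.

Definition op_lim_fun x : H := lim (fun P => F (fun A => P (A x))).

Lemma op_lim_pointwise x (e : R) :
  0 < e -> F (fun A => norm (minus (A x) (op_lim_fun x)) < e).
Proof.
move=> e0.
have PF : ProperFilter (fun P : H -> Prop => F (fun A => P (A x))).
  exact: filtermap_proper_filter.
have cx : cauchy (fun P : H -> Prop => F (fun A => P (A x))).
  move=> eps; have nx := norm_ge_0 x.
  have d0 : 0 < eps / (norm x + 1).
    by apply: Rdiv_lt_0_compat; [exact: cond_pos | lra].
  have [A hA] := cF (mkposreal _ d0); exists (A x).
  apply: filter_imp hA => B hB; apply: norm_compat1.
  apply: Rle_lt_trans (op_norm_bound (minus B A) x) _.
  apply: Rle_lt_trans (Rmult_le_compat_l _ _ (norm x + 1) (op_norm_ge0 _) _) _.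
    lra.
  have hB' : op_norm (minus B A) < eps / (norm x + 1) by [].
  have := Rmult_lt_compat_r (norm x + 1) _ _ ltac:(lra) hB'.
  by rewrite /Rdiv Rmult_assoc Rinv_l; lra.
have k0 := @norm_factor_gt_0 _ H.
have d0 : 0 < e / norm_factor (V := H) by exact: Rdiv_lt_0_compat.
have := complete_cauchy _ PF cx (mkposreal _ d0).
apply: filter_imp => A hA.
have := norm_compat2 _ _ _ hA => /=.
by have -> : norm_factor (V := H) * (e / norm_factor (V := H)) = e by field; lra.
Qed.

Lemma norm_minus_sym x y : norm (minus x y) = norm (minus y x).
Proof. by rewrite -norm_opp opp_minus. Qed.

Lemma norm_small_eq x y : (forall e, 0 < e -> norm (minus x y) < e) -> x = y.
Proof.
move=> h.
have /norm_eq_zero e : norm (minus x y) = 0.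
  case: (Rle_lt_or_eq_dec _ _ (norm_ge_0 (minus x y))) => // p.
  by have := h _ p; lra.
by rewrite -(plus_zero_r x) -(plus_opp_l y) plus_assoc -/(minus x y) e plus_zero_l.
Qed.

Lemma op_lim_near A (d : R) x :
  F (op_ball A d) -> norm (minus (op_lim_fun x) (A x)) <= d * norm x.
Proof.
move=> hA; apply: le_epsilon => e e0.
have [B [hB1 hB2]] := filter_ex _ (filter_and _ _ hA (@op_lim_pointwise x e e0)).
rewrite (minus_trans (B x)).
apply: Rle_trans (norm_triangle _ _) _.
have h1 := op_norm_bound (minus B A) x.
have h2 : op_norm (minus B A) * norm x <= d * norm x.
  by apply: Rmult_le_compat_r; [exact: norm_ge_0 | apply: Rlt_le].
have : norm (minus (op_lim_fun x) (B x)) < e.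
  by rewrite -norm_opp opp_minus.
have h1' : norm (minus (B x) (A x)) <= op_norm (minus B A) * norm x by exact: h1.
lra.
Qed.

Lemma op_lim_linear : is_linear op_lim_fun.
Proof.
split.
- move=> x y; apply: norm_small_eq => e e0.
  have e3 : 0 < e / 3 by lra.
  have [B [h1 [h2 h3]]] := filter_ex _ (filter_and _ _ (@op_lim_pointwise (plus x y) _ e3)
    (filter_and _ _ (@op_lim_pointwise x _ e3) (@op_lim_pointwise y _ e3))).
  rewrite (minus_trans (B (plus x y))).
  apply: Rle_lt_trans (norm_triangle _ _) _.
  have E : minus (B (plus x y)) (plus (op_lim_fun x) (op_lim_fun y)) =
    plus (minus (B x) (op_lim_fun x)) (minus (B y) (op_lim_fun y)).
    rewrite (linear_plus _ (op_linear B)) /minus opp_plus -!plus_assoc.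
    congr plus; rewrite !plus_assoc; congr plus; exact: plus_comm.
  rewrite E (norm_minus_sym (op_lim_fun (plus x y))).
  apply: Rle_lt_trans (Rplus_le_compat_l _ _ _ (norm_triangle _ _)) _; lra.
- move=> k x; apply: norm_small_eq => e e0.
  have k0 : 0 <= abs k by exact: abs_ge_0.
  have e2 : 0 < e / 2 by lra.
  have e3 : 0 < e / 2 / (abs k + 1) by apply: Rdiv_lt_0_compat; lra.
  have [B [h1 h2]] := filter_ex _ (filter_and _ _ (@op_lim_pointwise (scal k x) _ e2)
    (@op_lim_pointwise x _ e3)).
  rewrite (minus_trans (B (scal k x))).
  apply: Rle_lt_trans (norm_triangle _ _) _.
  have E : minus (B (scal k x)) (scal k (op_lim_fun x)) =
    scal k (minus (B x) (op_lim_fun x)).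
    by rewrite (linear_scal _ (op_linear B)) /minus scal_distr_l scal_opp_r.
  rewrite E (norm_minus_sym (op_lim_fun (scal k x))).
  apply: Rle_lt_trans (Rplus_le_compat_l _ _ _ (norm_scal _ _)) _.
  have h4 := Rmult_le_compat_l _ _ _ k0 (Rlt_le _ _ h2).
  have h5 : abs k * (e / 2 / (abs k + 1)) <= e / 2.
    apply: Rle_trans (Rmult_le_compat_r _ _ (abs k + 1) (Rlt_le _ _ e3) _) _; first lra.
    by right; field; lra.
  lra.
- have [A hA] := cF (mkposreal _ Rlt_0_1); exists (op_norm A + 1).
  have A0 := op_norm_ge0 A; split=> [|x]; first lra.
  have h1 : norm (minus (op_lim_fun x) (A x)) <= 1 * norm x by exact: op_lim_near.
  have h2 := op_norm_bound A x.
  have -> : op_lim_fun x = plus (minus (op_lim_fun x) (A x)) (A x).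
    by rewrite /minus -plus_assoc plus_opp_l plus_zero_r.
  apply: Rle_trans (norm_triangle _ _) _.
  by rewrite Rmult_plus_distr_r; lra.
Qed.

Lemma op_lim_ex : exists L : Op H, forall eps : posreal, F (ball L eps).
Proof.
exists (MkOp op_lim_linear) => eps; have e0 := cond_pos eps.
have d0 : 0 < eps / 3 by lra.
have [A hA] := cF (mkposreal _ d0).
apply: filter_imp (hA) => B hB.
have h1 : op_norm (minus A (MkOp op_lim_linear)) <= eps / 3.
  apply: op_norm_le => [|x]; first lra.
  have h : norm (minus (A x) (op_lim_fun x)) <= eps / 3 * norm x.
    by rewrite -norm_opp opp_minus; exact: (op_lim_near x hA).
  exact: h.
have h2 : op_norm (minus B A) < eps / 3 by exact: hB.
rewrite /ball /= /op_ball (minus_trans A).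
by apply: Rle_lt_trans (op_norm_triangle _ _) _; lra.
Qed.

End Completeness.

Definition op_lim (F : (Op H -> Prop) -> Prop) : Op H :=
  epsilon (inhabits op_zero) (fun L => forall eps : posreal, F (ball L eps)).

Definition Op_CompleteSpace_mixin : CompleteSpace.mixin_of Op_UniformSpace.
Proof.
apply: (CompleteSpace.Mixin _ op_lim).
- move=> F FF cF; exact: (epsilon_spec _ _ (op_lim_ex FF cF)).
- move=> F1 F2 h12 h21.
  suff -> : F1 = F2 by exact: close_refl.
  apply: functional_extensionality => P; apply: propositional_extensionality.
  by split; [exact: h21 | exact: h12].
Defined.

Canonical Op_CompleteSpace :=
  CompleteSpace.Pack (Op H) (CompleteSpace.Class _ _ Op_CompleteSpace_mixin) (Op H).

Canonical Op_CompleteNormedModule :=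
  CompleteNormedModule.Pack R_AbsRing (Op H)
    (CompleteNormedModule.Class R_AbsRing _ (NormedModule.class _ Op_NormedModule)
       Op_CompleteSpace_mixin) (Op H).

End OpAlgebra.

(** * Adjoint, order, spectrum, functional calculus *)

Section OperatorTheory.

Context {H : HilbertSpace}.
Implicit Types (A S T : Op H).

Definition adjoint A : Op H :=
  epsilon (inhabits op_zero) (fun B : Op H => forall x y, inner (A x) y = inner x (B y)).

Definition selfadjoint A : Prop := adjoint A = A.

Definition op_le S T : Prop :=
  forall x, exists r : R, 0 <= r /\ inner ((minus T S) x) x = RtoC r.

Definition numerical_radius A : R :=
  real (Lub_Rbar (fun r => exists x : H, norm x = 1 /\ r = Cmod (inner (A x) x))).

Definition spectrum A (z : C) : Prop :=
  ~ exists B : Op H, mult B (minus A (op_scalar z)) = one /\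
                     mult (minus A (op_scalar z)) B = one.

Definition spectrum_in (J : R -> Prop) A : Prop :=
  forall z, spectrum A z -> exists x : R, J x /\ z = RtoC x.

(** For selfadjoint [A] and [f] continuous on the spectrum of [A], [f(A)] is
    the norm limit of [p_n(A)] for any real polynomials [p_n] converging to
    [f] uniformly on the spectrum. *)
Definition is_cfc (f : R -> R) A S : Prop :=
  forall eps : posreal, exists (n : nat) (a : nat -> R),
    (forall x : R, spectrum A (RtoC x) ->
       Rabs (f x - sum_n (fun k => a k * x ^ k) n) < eps) /\
    norm (minus S (sum_n (fun k => scal (a k) (pow_n A k)) n)) < eps.

Definition cfc (f : R -> R) A : Op H := epsilon (inhabits op_zero) (is_cfc f A).

Definition op_abs A : Op H := cfc sqrt (mult (adjoint A) A).

End OperatorTheory.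

Definition operator_convex (H : HilbertSpace) (J : R -> Prop) (f : R -> R) : Prop :=
  continuous_on J f /\
  forall S T : Op H, selfadjoint S -> selfadjoint T ->
    spectrum_in J S -> spectrum_in J T ->
    forall t, 0 <= t <= 1 ->
      op_le (cfc f (plus (scal (1 - t) S) (scal t T)))
            (plus (scal (1 - t) (cfc f S)) (scal t (cfc f T))).

(* Main.v *)
(** Write [X] for the operator of the statement and [T t = (1 - t) X + t w^2].
    The mixed Schwarz inequality [|<Ax,x>| <= <(|A| + |A*|)/2 x, x>] and
    [|<Ax,x>| <= |Ax|] give [|<Ax,x>|^2 <= <Xx,x>], hence also
    [|<Ax,x>|^2 <= <T t x, x>], for unit vectors [x].  A support line of the
    convex increasing [f] then gives [f (|<Ax,x>|^2) <= <f(T t) x, x>], which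
    integrates to the first inequality after taking the supremum over [x].
    Operator convexity gives [0 <= f(T t) <= (1 - t) f(X) + t f(w^2)], and
    [f(w^2) <= |f(X)|] by the case [t = 0] of the previous bound.

    The functional calculus rests on one fact: a real polynomial that is
    nonnegative on the spectrum of a symmetric [T] is a positive operator at
    [T]; it follows from factoring the polynomial over [C]. *)

Require Import Defs.
From Stdlib Require Import Reals Lra List ssreflect ClassicalEpsilon.
From Coquelicot Require Import Coquelicot.
From mathcomp Require ssrbool eqtype bigop ssralg ssrnat fintype Rstruct complex.
Set Implicit Arguments.
Unset Strict Implicit.
Unset Printing Implicit Defensive.
Open Scope R_scope.

(** [adjoint] and [cfc] are defined by choice, so nothing can be said of them before existence is
    proved: this brings in the Riesz theorem, completeness of the operator space and Weierstrass
    approximation. The calculus is handled through approximation alone: an identity or inequality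
    for [f(T)] is first an estimate for polynomials, valid up to an error [e], and then [e] tends to
    [0]. The sign of a polynomial at [T] is decided at the infimum of its numerical range, where the
    shifted operator fails to be bounded below; hence lower bounds, rather than inverses, are
    propagated through the factorization. A support line is itself a polynomial, of degree one, so
    the Jensen step needs no more than positivity of polynomials. The supremum defining [w(A)] need
    not be attained: everything is proved at a fixed unit vector, and continuity of [f] carries the
    estimate to the supremum. *)

Fixpoint monic_eval (l : list C) (z : C) : C :=
  match l with nil => RtoC 1 | c :: l' => Cplus c (Cmult z (monic_eval l' z)) end.

Module FundamentalTheoremOfAlgebra.
Import ssreflect ssrbool eqtype ssrnat fintype bigop ssralg Rstruct complex.
Import GRing.Theory.

(** The leading coefficient 1 is implicit, so the length of the list is the degree. The root is
    found in the algebraically closed field [R[i]] of MathComp and transported to Coquelicot's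
    [C]. *)
Lemma monic_eval_root (l : list C) : l <> nil -> exists z : C, monic_eval l z = RtoC 0.
Proof.
pose toC (z : R[i]) : C := (complex.Re z, complex.Im z).
pose ofC (c : C) : R[i] := complex.Complex (fst c) (snd c).
(* The signs are reversed because [solve_monicpoly] solves [x ^ n = \sum P i * x ^ i]. *)
pose P i := (- ofC (List.nth i l (RtoC 0)))%R.
have step (c : C) (x y : R[i]) :
    Cplus c (Cmult (toC x) (toC y)) = toC (ofC c + x * y)%R.
  by case: c => a b; case: x => p q; case: y.
have evalE (x : R[i]) : monic_eval l (toC x) =
    toC (x ^+ length l + \sum_(i < length l) ofC (List.nth i l (RtoC 0)) * x ^+ i)%R.
  clear P; elim: l => [|c l IH]; first by rewrite big_ord0 addr0 expr0.
  rewrite /= big_ord_recl expr0 mulr1 /=.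
  rewrite (eq_bigr (fun i : 'I_(length l) =>
    x * (ofC (List.nth i l (RtoC 0)) * x ^+ i))%R); last first.
    by move=> i _; rewrite /bump leq0n add1n exprS mulrCA.
  rewrite -mulr_sumr exprS addrCA -mulrDr.
  by rewrite IH; exact: step.
move=> l0; have len_gt0 : (0 < length l)%N.
  by case: (l) l0 => [[]|c l'] //=; exact: ltn0Sn.
have [x] := @solve_monicpoly _ (length l) P len_gt0.
move=> xE; exists (toC x); rewrite evalE xE -big_split big1 //.
by move=> i _; rewrite /= /P mulNr addNr.
Qed.

End FundamentalTheoremOfAlgebra.

(** * The real inner product *)

Section RealInnerProduct.
Context {H : HilbertSpace}.
Implicit Types (x y z : H) (A S T P : Op H).

Lemma inner_scal_r (a : C) x y : inner x (scal a y) = Cmult (Cconj a) (inner x y).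
Proof. by rewrite inner_conj inner_scal_l Cmult_conj -(inner_conj _ x). Qed.

Lemma scal_opp_one_C x : opp x = scal (RtoC (-1)) x.
Proof.
have -> : RtoC (-1) = opp (one : C_Ring) by rewrite /opp /one /= -RtoC_opp.
by rewrite (scal_opp_one (K := C_Ring)).
Qed.

Lemma inner_opp_l x y : inner (opp x) y = Copp (inner x y).
Proof.
rewrite scal_opp_one_C inner_scal_l; case: (inner x y) => a b.
by congr pair => /=; ring.
Qed.

Lemma inner_minus_l x y z : inner (minus x y) z = Cminus (inner x z) (inner y z).
Proof. by rewrite /minus inner_plus_l inner_opp_l. Qed.

Lemma inner_zero_l y : inner zero y = RtoC 0.
Proof. by rewrite -(plus_opp_r zero) inner_plus_l inner_opp_l Cplus_opp_r. Qed.

(** The real part alone turns estimates into real arithmetic, and loses nothing: by [inner_ip] the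
    imaginary part is its value at [- i x]. *)
Definition ip x y : R := Re (inner x y).

Definition rscal (r : R) x : H := scal (RtoC r) x.

Lemma ip_sym x y : ip x y = ip y x.
Proof. by rewrite /ip (inner_conj y x) re_conj. Qed.

Lemma ip_plus_l x y z : ip (plus x y) z = ip x z + ip y z.
Proof. by rewrite /ip inner_plus_l. Qed.

Lemma ip_scal_l r x y : ip (rscal r x) y = r * ip x y.
Proof.
by rewrite /ip /rscal inner_scal_l; case: (inner x y) => a b; rewrite /Re /=; ring.
Qed.

Lemma ip_opp_l x y : ip (opp x) y = - ip x y.
Proof. by rewrite /ip inner_opp_l. Qed.

Lemma ip_minus_l x y z : ip (minus x y) z = ip x z - ip y z.
Proof. by rewrite /ip inner_minus_l. Qed.

Lemma ip_zero_l y : ip zero y = 0.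
Proof. by rewrite /ip inner_zero_l. Qed.

Lemma ip_plus_r x y z : ip x (plus y z) = ip x y + ip x z.
Proof. by rewrite !(ip_sym x) ip_plus_l. Qed.

Lemma ip_scal_r r x y : ip x (rscal r y) = r * ip x y.
Proof. by rewrite !(ip_sym x) ip_scal_l. Qed.

Lemma ip_opp_r x y : ip x (opp y) = - ip x y.
Proof. by rewrite !(ip_sym x) ip_opp_l. Qed.

Lemma ip_minus_r x y z : ip x (minus y z) = ip x y - ip x z.
Proof. by rewrite !(ip_sym x) ip_minus_l. Qed.

Lemma ip_zero_r x : ip x zero = 0.
Proof. by rewrite ip_sym ip_zero_l. Qed.

Lemma ip_norm x : ip x x = norm x ^ 2.
Proof. by rewrite /ip inner_norm. Qed.

Lemma ip_Cscal (c : C) x y : ip (scal c x) y = ip x (scal (Cconj c) y).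
Proof. by rewrite /ip inner_scal_l inner_scal_r Cconj_conj. Qed.

Lemma inner_ip x y : inner x y = (ip x y, ip (scal (Copp Ci) x) y).
Proof.
rewrite /ip inner_scal_l; case: (inner x y) => a b.
by congr pair; rewrite /Re /=; ring.
Qed.

Lemma ip_ge0 x : 0 <= ip x x.
Proof. by rewrite ip_norm; apply: pow2_ge_0. Qed.

Lemma ip_eq0 x : ip x x = 0 -> x = zero.
Proof.
rewrite ip_norm => h; apply: norm_eq_zero; have := norm_ge_0 x; nra.
Qed.

Lemma minus_eq0 x y : minus x y = zero -> x = y.
Proof.
by move=> h; rewrite -(plus_zero_l y) -h /minus -plus_assoc plus_opp_l plus_zero_r.
Qed.

Lemma ip_ext x y : (forall z, ip x z = ip y z) -> x = y.
Proof.
move=> h; apply: minus_eq0; apply: ip_eq0.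
by rewrite ip_minus_l h Rminus_diag.
Qed.

Lemma inner_ext x y : (forall z, inner x z = inner y z) -> x = y.
Proof. by move=> h; apply: ip_ext => z; rewrite /ip h. Qed.

Lemma norm_le_sqr x (r : R) : 0 <= r -> ip x x <= r ^ 2 -> norm x <= r.
Proof. rewrite ip_norm => r0 h; have := norm_ge_0 x; nra. Qed.

(** The axioms of a normed module give only one inequality; equality comes from the inner
    product. *)
Lemma norm_Cscal (c : C) x : norm (scal c x) = Cmod c * norm x.
Proof.
have nx := norm_ge_0 x; have n1 := norm_ge_0 (scal c x); have nc := Cmod_ge_0 c.
have := ip_norm (scal c x).
rewrite ip_Cscal scal_assoc /mult /= Cmult_comm -Cmod2_conj
  -/(rscal _ _) ip_scal_r ip_norm => h.
have h0 : 0 <= Cmod c * norm x by exact: Rmult_le_pos.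
by apply: Rsqr_inj; rewrite // /Rsqr; nra.
Qed.

Lemma norm_rscal r x : norm (rscal r x) = Rabs r * norm x.
Proof. by rewrite /rscal norm_Cscal Cmod_R. Qed.

Lemma op_plusE A B x : (plus A B) x = plus (A x) (B x).
Proof. by []. Qed.
Lemma op_minusE A B x : (minus A B) x = minus (A x) (B x).
Proof. by []. Qed.
Lemma op_oppE A x : (opp A) x = opp (A x).
Proof. by []. Qed.
Lemma op_multE A B x : (mult A B) x = A (B x).
Proof. by []. Qed.
Lemma op_scalE (r : R) A x : (scal r A) x = rscal r (A x).
Proof. by []. Qed.
Lemma op_oneE x : (one : Op H) x = x.
Proof. by []. Qed.
Lemma op_one'E x : (op_one : Op H) x = x.
Proof. by []. Qed.
Lemma op_zeroE x : (zero : Op H) x = zero.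
Proof. by []. Qed.
Lemma op_scalarE (c : C) x : (op_scalar c : Op H) x = scal c x.
Proof. by []. Qed.
Definition opE := (op_plusE, op_minusE, op_oppE, op_multE, op_scalE, op_oneE,
  op_one'E, op_zeroE, op_scalarE).

Lemma opD A x y : A (plus x y) = plus (A x) (A y).
Proof. exact: (linear_plus _ (op_linear A)). Qed.
Lemma opZ A (c : C) x : A (scal c x) = scal c (A x).
Proof. exact: (linear_scal _ (op_linear A)). Qed.
Lemma opRZ A r x : A (rscal r x) = rscal r (A x).
Proof. exact: opZ. Qed.
Lemma op0 A : A zero = zero.
Proof. exact: (linear_zero _ (op_linear A)). Qed.
Lemma opN A x : A (opp x) = opp (A x).
Proof. by rewrite !scal_opp_one_C opZ. Qed.
Lemma opB A x y : A (minus x y) = minus (A x) (A y).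
Proof. by rewrite /minus opD opN. Qed.

Definition ipE := (ip_plus_l, ip_minus_l, ip_scal_l, ip_opp_l, ip_zero_l,
  ip_plus_r, ip_minus_r, ip_scal_r, ip_opp_r, ip_zero_r).
Definition opL := (opD, opB, opRZ, opN, op0).

(** Self-adjointness without reference to the chosen [adjoint]. Complex linearity of [S] upgrades
    the identity from the real part to the full inner product. *)
Definition symmetric S : Prop := forall x y, ip (S x) y = ip x (S y).
Definition op_nonneg S : Prop := forall x, 0 <= ip (S x) x.

(** Serves twice: for Cauchy-Schwarz, and with [a = 0] as the first-order condition at a minimum. *)
Lemma quadratic_discriminant (a b c : R) :
  (forall r, 0 <= a + 2 * r * b + r ^ 2 * c) -> b ^ 2 <= a * c.
Proof.
move=> h; have a0 := h 0; case: (Req_dec c 0) => [c0|c0].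
  have h1 := h ((- a - 1) / (2 * b)); case: (Req_dec b 0) => [b0|b0].
    by rewrite b0 c0; lra.
  move: h1; rewrite c0.
  have -> : 2 * ((- a - 1) / (2 * b)) * b = - a - 1 by field.
  lra.
have c1 : 0 < c.
  case: (Rlt_dec 0 c) => // nc.
  (* Adding the values at opposite arguments removes the linear term; for [c < 0] the remaining
     [a + (k + 1) ^ 2 * c] is negative. *)
  have h1 := h ((Rabs b + 1 + Rabs a) / - c ).
  have h2 := h (- ((Rabs b + 1 + Rabs a) / - c )).
  have cc : 0 < - c by lra.
  set k := (Rabs b + 1 + Rabs a) / - c in h1 h2.
  have kc : k * (- c) = Rabs b + 1 + Rabs a by rewrite /k; field; lra.
  have h3 : 0 <= a + k * (k * c) by nra.
  have k0 : 0 < k.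
    by apply: Rdiv_lt_0_compat => //; have := Rabs_pos b; have := Rabs_pos a; lra.
  have h4 := h (k + 1). have h5 := h (- (k + 1)).
  have h6 : 0 <= a + (k + 1) * ((k + 1) * c) by nra.
  have kc' : (k + 1) * c <= - (1 + Rabs a) by have := Rabs_pos b; nra.
  have := Rle_abs a; have := Rabs_pos a; nra.
have h1 := h (- b / c).
have : a + 2 * (- b / c) * b + (- b / c) ^ 2 * c = (a * c - b ^ 2) / c.
  by field.
move=> e; rewrite e in h1.
have : (a * c - b ^ 2) / c * c = a * c - b ^ 2 by field.
nra.
Qed.

Lemma positive_cauchy_schwarz P x y : symmetric P -> op_nonneg P ->
  (ip (P x) y) ^ 2 <= ip (P x) x * ip (P y) y.
Proof.
move=> sP pP; apply: quadratic_discriminant => r.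
have := pP (plus x (rscal r y)).
rewrite !opL !ipE (sP y x) (ip_sym y); lra.
Qed.

Lemma ip_le_norm x y : ip x y <= norm x * norm y.
Proof.
have := @positive_cauchy_schwarz one x y (fun _ _ => eq_refl) ip_ge0.
rewrite !opE !ip_norm => h; have := norm_ge_0 x; have := norm_ge_0 y.
move=> hx hy; have : 0 <= norm x * norm y by exact: Rmult_le_pos.
nra.
Qed.

Lemma Rabs_ip_le x y : Rabs (ip x y) <= norm x * norm y.
Proof.
apply/Rabs_le_between; split; last exact: ip_le_norm.
have := ip_le_norm (opp x) y; rewrite norm_opp ip_opp_l; lra.
Qed.

Lemma norm_op_apply A x : norm (A x) <= norm A * norm x.
Proof. exact: op_norm_bound. Qed.

Lemma ip_op_bound A x : Rabs (ip (A x) x) <= norm A * norm x ^ 2.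
Proof.
apply: Rle_trans (Rabs_ip_le _ _) _; 
have := Rmult_le_compat_r _ _ _ (norm_ge_0 x) (norm_op_apply A x); lra.
Qed.

(** Polarization: [4 <Sx, y>] is the difference of the quadratic form at [x + y] and [x - y], and
    the parallelogram law bounds it. *)
Lemma symmetric_norm_le S m : symmetric S -> 0 <= m ->
  (forall x, Rabs (ip (S x) x) <= m * ip x x) -> norm S <= m.
Proof.
move=> sS m0 h; apply: le_epsilon => e e0; apply: op_norm_le => [|x]; first lra.
apply: norm_le_sqr.
  by apply: Rmult_le_pos; [lra | exact: norm_ge_0].
(* The margin [e] makes [k] invertible even when [m = 0]; the vector tested below is [Sx / k]. *)
set k := m + e; have k0 : 0 < k by rewrite /k; lra.
have b y : Rabs (ip (S y) y) <= k * ip y y.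
  by apply: Rle_trans (h y) _; have := ip_ge0 y; rewrite /k; nra.
have pol y : 4 * ip (S x) y <= 2 * k * (ip x x + ip y y).
  have /Rabs_le_between h1 := b (plus x y); have /Rabs_le_between h2 := b (minus x y).
  move: h1 h2; rewrite !opL !ipE (sS y x) (ip_sym y (S x)) (ip_sym y x); lra.
have := pol (rscal (/ k) (S x)).
rewrite !ipE; set q := ip (S x) (S x).
rewrite Rpow_mult_distr -ip_norm => h3.
have := Rmult_le_compat_l (k / 2) _ _ ltac:(lra) h3.
have -> : k / 2 * (4 * (/ k * q)) = 2 * q by field; lra.
have -> : k / 2 * (2 * k * (ip x x + / k * (/ k * q))) = k ^ 2 * ip x x + q.
  by field; lra.
lra.
Qed.

End RealInnerProduct.

(** * Riesz representation, adjoints and inverses *)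

Lemma exists_infimum (T : Type) (t0 : T) (J : T -> R) (b : R) : (forall t, b <= J t) ->
  exists m, (forall t, m <= J t) /\ (forall e, 0 < e -> exists t, J t < m + e).
Proof.
move=> hb; case: (completeness (fun r => exists t, r = - J t)).
- by exists (- b) => r [t ->]; have := hb t; lra.
- by exists (- J t0), t0.
move=> s [ub lub]; exists (- s); split=> [t|e e0].
  by have := ub (- J t) (ex_intro _ t eq_refl); lra.
apply: NNPP => h; have : s <= s - e; last lra.
apply: lub => r [t ->]; apply: Rnot_lt_le => lt; apply: h; exists t; lra.
Qed.

Section Representation.
Context {H : HilbertSpace}.
Implicit Types (x y z u h : H) (A B S T P : Op H).

(** Lax-Milgram for symmetric forms: the representing vector minimises
    [ip (S x) x - 2 phi x].  For [S = one] this is the Riesz theorem. *)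
Lemma coercive_representation S (c K : R) (phi : H -> R) :
  symmetric S -> 0 < c -> (forall x, c * ip x x <= ip (S x) x) ->
  (forall x y, phi (plus x y) = phi x + phi y) ->
  (forall r x, phi (rscal r x) = r * phi x) ->
  (forall x, Rabs (phi x) <= K * norm x) ->
  exists u, forall h, ip (S u) h = phi h.
Proof.
move=> sS c0 coer phiD phiZ phiB.
pose J x := ip (S x) x - 2 * phi x.
have JB x : - (K ^ 2 / c) <= J x.
  have h1 := coer x; have /Rabs_le_between h2 := phiB x.
  rewrite ip_norm in h1; rewrite /J.
  have : 0 <= (c * norm x - K) ^ 2 / c.
    by apply: Rdiv_le_0_compat => //; exact: pow2_ge_0.
  have -> : (c * norm x - K) ^ 2 / c = c * norm x ^ 2 - 2 * K * norm x + K ^ 2 / c.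
    by field; lra.
  lra.
have [m [mJ Jm]] := exists_infimum zero JB.
have JE x h r : J (plus x (rscal r h)) =
    J x + 2 * r * (ip (S x) h - phi h) + r ^ 2 * ip (S h) h.
  by rewrite /J phiD phiZ !opL !ipE (sS h x) (ip_sym h); ring.
(* The filter generated by the sets of near-minimisers takes the place of a minimising sequence. *)
pose F (Q : H -> Prop) := exists e, 0 < e /\ forall x, J x < m + e -> Q x.
have PF : ProperFilter F.
  split=> [Q [e [e0 hQ]]|]; first by have [x hx] := Jm e e0; exists x; exact: hQ.
  split.
  - by exists 1; split=> //; lra.
  - move=> P Q [e [e0 hP]] [d [d0 hQ]]; exists (Rmin e d).
    split=> [|x hx]; first exact: Rmin_pos.
    have := Rmin_l e d; have := Rmin_r e d => ? ?.
    by split; [apply: hP | apply: hQ]; lra.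
  - by move=> P Q PQ [e [e0 hP]]; exists e; split=> // x /hP; exact: PQ.
have cF : cauchy F.
  move=> eps; have ep := cond_pos eps.
  (* The parallelogram law below bounds [c * norm (minus y x) ^ 2] by [4 * e], which is less than
     [c * eps ^ 2]. *)
  pose e := c * eps ^ 2 / 8.
  have e0 : 0 < e.
    by apply: Rdiv_lt_0_compat; [apply: Rmult_lt_0_compat => //; exact: pow_lt | lra].
  have [x hx] := Jm e e0; exists x, e; split=> // y hy.
  apply: norm_compat1.
  (* Parallelogram law for the form [ip (S x) y]. *)
  have par : ip (S (minus y x)) (minus y x) =
      2 * J x + 2 * J y - 4 * J (plus x (rscal (/ 2) (minus y x))).
    rewrite /J phiD phiZ /minus phiD scal_opp_one_C -/(rscal (-1) x) phiZ.
    rewrite !opL !ipE (sS x y) (ip_sym x (S y)); field.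
  have h1 := mJ (plus x (rscal (/ 2) (minus y x))).
  have := coer (minus y x); rewrite par ip_norm.
  set n := norm _ => h2; have n0 : 0 <= n by exact: norm_ge_0.
  have h3 : c * n ^ 2 < c * eps ^ 2 by rewrite /e in hx hy e0; lra.
  have h4 : n ^ 2 < eps ^ 2 by apply: (Rmult_lt_reg_l c).
  by apply: Rnot_le_lt => le; have := Rmult_le_compat _ _ _ _ (Rlt_le _ _ ep)
    (Rlt_le _ _ ep) le le; lra.
set u := lim F; exists u => h.
have near d : 0 < d -> exists e, 0 < e /\ forall x, J x < m + e -> norm (minus x u) < d.
  move=> d0; have k0 := @norm_factor_gt_0 _ H.
  have d1 : 0 < d / norm_factor (V := H) by exact: Rdiv_lt_0_compat.
  have [e [e0 he]] := complete_cauchy _ PF cF (mkposreal _ d1).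
  exists e; split=> // x /he /norm_compat2 /=.
  by have -> : norm_factor (V := H) * (d / norm_factor (V := H)) = d by field; lra.
(* First-order condition at [u]. The form is expanded at a near-minimiser [x], and only its linear
   term is moved to [u], so [J u] is never evaluated; [k] bounds the cost of that move. *)
suff : (ip (S u) h - phi h) ^ 2 <= 0 * ip (S h) h by nra.
apply: quadratic_discriminant => r; apply: le_epsilon => e e0.
pose k := 2 * Rabs r * (norm S * norm h).
have k0 : 0 <= k.
  by rewrite /k; do !apply: Rmult_le_pos; try exact: norm_ge_0; [lra | exact: Rabs_pos].
have d0 : 0 < e / 2 / (k + 1) by apply: Rdiv_lt_0_compat; lra.
have [e1 [e10 he1]] := near _ d0.
have e2 : 0 < Rmin e1 (e / 2) by apply: Rmin_pos; lra.
have [x hx] := Jm _ e2.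
have := Rmin_l e1 (e / 2); have := Rmin_r e1 (e / 2) => m1 m2.
have xu := he1 x ltac:(lra).
have := mJ (plus x (rscal r h)); rewrite JE.
have -> : ip (S x) h = ip (S u) h + ip (S (minus x u)) h by rewrite !opL !ipE; ring.
have h1 : Rabs (r * ip (S (minus x u)) h) <= Rabs r * (norm S * norm h) * norm (minus x u).
  rewrite Rabs_mult Rmult_assoc; apply: Rmult_le_compat_l; first exact: Rabs_pos.
  apply: Rle_trans (Rabs_ip_le _ _) _.
  have := Rmult_le_compat_r _ _ _ (norm_ge_0 h) (norm_op_apply S (minus x u)); lra.
have /Rabs_le_between h1' := h1.
have h2 : k * norm (minus x u) <= e / 2.
  apply: Rle_trans (Rmult_le_compat_l _ _ _ k0 (Rlt_le _ _ xu)) _.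
  apply: Rle_trans (Rmult_le_compat_r _ _ (k + 1) (Rlt_le _ _ d0) _) _; first lra.
  by right; field; lra.
rewrite /k in h2; lra.
Qed.

(** Uniqueness turns a linear relation into a linear choice function. *)
Lemma exists_op (Rel : H -> H -> Prop) (K : R) :
  (forall y, exists u, Rel y u) -> (forall y u v, Rel y u -> Rel y v -> u = v) ->
  (forall y z u v, Rel y u -> Rel z v -> Rel (plus y z) (plus u v)) ->
  (forall c y u, Rel y u -> Rel (scal c y) (scal c u)) ->
  (forall y u, Rel y u -> norm u <= K * norm y) ->
  exists B : Op H, forall y, Rel y (B y).
Proof.
move=> ex uni RD RZ RB.
pose g y := proj1_sig (constructive_indefinite_description _ (ex y)).
have gR y : Rel y (g y) := proj2_sig (constructive_indefinite_description _ (ex y)).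
have gl : is_linear g.
  split.
  - by move=> x y; apply: uni (gR _) _; exact: RD.
  - by move=> c x; apply: uni (gR _) _; exact: RZ.
  (* [is_linear] asks for a positive bound, whereas [K] may be zero. *)
  - exists (Rmax K 1); split=> [|x]; first by have := Rmax_r K 1; lra.
    apply: Rle_trans (RB _ _ (gR x)) _; apply: Rmult_le_compat_r; first exact: norm_ge_0.
    exact: Rmax_l.
by exists (MkOp gl).
Qed.

(** Existence behind the choice in [adjoint]: for each [y], Riesz represents the functional
    [h -> ip (A h) y]. *)
Lemma adjoint_ip A x y : ip (A x) y = ip x (adjoint A y).
Proof.
suff [B hB] : exists B : Op H, forall x y, inner (A x) y = inner x (B y).
  by rewrite /ip; congr Re; exact: (epsilon_spec (inhabits op_zero)
    (fun B : Op H => forall x y, inner (A x) y = inner x (B y)) (ex_intro _ B hB)).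
clear x y; have [B hB] : exists B : Op H, forall y h, ip (B y) h = ip (A h) y.
  apply: (@exists_op (fun y u => forall h, ip u h = ip (A h) y) (norm A)).
  - move=> y; apply: (@coercive_representation one 1 (norm A * norm y)).
    + by [].
    + lra.
    + by move=> z; rewrite opE; lra.
    + by move=> z1 z2; rewrite opD ipE.
    + by move=> r z; rewrite opRZ ipE.
    + move=> z; apply: Rle_trans (Rabs_ip_le _ _) _.
      have := Rmult_le_compat_r _ _ _ (norm_ge_0 y) (norm_op_apply A z); lra.
  - by move=> y u v hu hv; apply: ip_ext => h; rewrite hu hv.
  - by move=> y z u v hu hv h; rewrite !ipE hu hv.
  - move=> c y u hu h; rewrite ip_Cscal hu opZ ip_Cscal.
    by rewrite Cconj_conj.
  (* Testing at [u] itself gives [norm u ^ 2 = ip (A u) y], hence the bound [norm A] after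
     cancelling [norm u]. *)
  - move=> y u hu; have := hu u; rewrite ip_norm => e.
    have := ip_le_norm (A u) y; rewrite -e => h1.
    have h2 := Rmult_le_compat_r _ _ _ (norm_ge_0 y) (norm_op_apply A u).
    case: (Req_dec (norm u) 0) => [->|nz].
      by apply: Rmult_le_pos; exact: norm_ge_0.
    have := norm_ge_0 u => n0; apply: (Rmult_le_reg_l (norm u)); lra.
exists B => z1 z2; rewrite !inner_ip; congr pair.
  by rewrite -hB ip_sym.
by rewrite -opZ -hB ip_sym.
Qed.

Lemma symmetric_selfadjoint S : symmetric S -> selfadjoint S.
Proof.
move=> sS; apply: op_ext => x; apply: ip_ext => z.
by rewrite ip_sym -adjoint_ip sS ip_sym.
Qed.

Lemma adjointK A : adjoint (adjoint A) = A.
Proof.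
by apply: op_ext => x; apply: ip_ext => z; rewrite ip_sym -adjoint_ip ip_sym adjoint_ip.
Qed.

Definition invertible A := exists B : Op H, mult B A = one /\ mult A B = one.

Definition bounded_below A := exists c : R, 0 < c /\ forall x, c * norm x <= norm (A x).

Lemma invertible_bounded_below A : invertible A -> bounded_below A.
Proof.
move=> [B [BA _]]; have nB := norm_ge_0 B.
exists (/ (norm B + 1)); split=> [|x]; first by apply: Rinv_0_lt_compat; lra.
have := norm_op_apply B (A x); rewrite -op_multE BA opE => h.
apply: (Rmult_le_reg_l (norm B + 1)); first lra.
rewrite -Rmult_assoc Rinv_r ?Rmult_1_l; last lra.
have := norm_ge_0 (A x); lra.
Qed.

(** The lower bound gives injectivity and bounds the inverse, doing the work of the open mapping
    theorem. *)
Lemma bounded_below_onto_invertible A :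
  bounded_below A -> (forall y, exists u, A u = y) -> invertible A.
Proof.
move=> [c [c0 hc]] onto.
have inj u v : A u = A v -> u = v.
  move=> e; apply: minus_eq0; apply: norm_eq_zero.
  have := hc (minus u v); rewrite opB e minus_eq_zero norm_zero.
  have := norm_ge_0 (minus u v); nra.
have [B hB] : exists B : Op H, forall y, A (B y) = y.
  apply: (@exists_op (fun y u => A u = y) (/ c)) => //.
  - by move=> y u v <- /inj.
  - by move=> y z u v <- <-; exact: opD.
  - by move=> k y u <-; exact: opZ.
  - move=> y u <-; apply: (Rmult_le_reg_l c) => //.
    by rewrite -Rmult_assoc Rinv_r ?Rmult_1_l; [exact: hc | lra].
exists B; split; apply: op_ext => x; rewrite !opE //.
by apply: inj; rewrite hB.
Qed.

Lemma coercive_onto S (c : R) : symmetric S -> 0 < c ->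
  (forall x, c * ip x x <= ip (S x) x) -> forall y, exists u, S u = y.
Proof.
move=> sS c0 coer y.
have [u hu] : exists u, forall h, ip (S u) h = ip y h.
  apply: (@coercive_representation S c (norm y)) => //.
  - by move=> *; rewrite ipE.
  - by move=> *; rewrite ipE.
  - by move=> x; exact: Rabs_ip_le.
by exists u; exact: ip_ext.
Qed.

Lemma coercive_bounded_below S (c : R) : 0 < c ->
  (forall x, c * ip x x <= ip (S x) x) -> bounded_below S.
Proof.
move=> c0 coer; exists c; split=> // x.
have := coer x; have := ip_le_norm (S x) x; rewrite ip_norm => h1 h2.
case: (Req_dec (norm x) 0) => [e|nz]; first by rewrite e Rmult_0_r; exact: norm_ge_0.
have := norm_ge_0 x => n0; apply: (Rmult_le_reg_r (norm x)); lra.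
Qed.

Lemma coercive_invertible S (c : R) : symmetric S -> 0 < c ->
  (forall x, c * ip x x <= ip (S x) x) -> invertible S.
Proof.
move=> sS c0 coer; apply: bounded_below_onto_invertible.
  exact: coercive_bounded_below coer.
exact: coercive_onto coer.
Qed.

End Representation.

(** * Spectra of symmetric operators *)

Ltac inner_ring :=
  repeat match goal with
  | |- context [inner ?a ?b] => case: (inner a b) => ? ?
  end;
  apply: injective_projections => /=; ring.

Section Spectrum.
Context {H : HilbertSpace}.
Implicit Types (x y z u h : H) (A B S T P : Op H).

(** If [N] inverts [A B], then [N B] is a left inverse of [A], which bounds it below, and [B N] is a
    right inverse. *)
Lemma invertible_commuting_factor A B : (forall x, A (B x) = B (A x)) ->
  invertible (mult A B) -> invertible A.
Proof.
move=> AB [N [NAB ABN]]; apply: bounded_below_onto_invertible.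
  have nB := norm_ge_0 (mult N B).
  exists (/ (norm (mult N B) + 1)); split=> [|x]; first by apply: Rinv_0_lt_compat; lra.
  have e : mult N B (A x) = x.
    by rewrite opE -AB; have := op_oneE x; rewrite -NAB.
  have := norm_op_apply (mult N B) (A x); rewrite e => h.
  apply: (Rmult_le_reg_l (norm (mult N B) + 1)); first lra.
  rewrite -Rmult_assoc Rinv_r ?Rmult_1_l; last lra.
  have := norm_ge_0 (A x); lra.
by move=> y; exists (B (N y)); have := op_oneE y; rewrite -ABN.
Qed.

Lemma symmetric_plus S T : symmetric S -> symmetric T -> symmetric (plus S T).
Proof. by move=> sS sT x y; rewrite !opE !ipE sS sT. Qed.

Lemma symmetric_scal r S : symmetric S -> symmetric (scal r S).
Proof. by move=> sS x y; rewrite !opE !ipE sS. Qed.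

Lemma symmetric_minus S T : symmetric S -> symmetric T -> symmetric (minus S T).
Proof. by move=> sS sT x y; rewrite !opE !ipE sS sT. Qed.

Lemma symmetric_mult S T : symmetric S -> symmetric T ->
  (forall x, S (T x) = T (S x)) -> symmetric (mult S T).
Proof. by move=> sS sT c x y; rewrite !opE sS sT c. Qed.

(** For [z = a + i b] with [b] nonzero, [(S - z)(S - conj z) = (S - a)^2 + b^2] is coercive, hence
    invertible. *)
Lemma spectrum_symmetric_real S (z : C) : symmetric S -> spectrum S z -> z = RtoC (Re z).
Proof.
move=> sS; case: z => a b spz; case: (Req_dec b 0) => [->|b0] //.
case: spz; pose W := minus S (scal a op_one).
have sW : symmetric W by apply: symmetric_minus => //; exact: symmetric_scal.
apply: (@invertible_commuting_factor _ (minus S (op_scalar (a, - b)))).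
  move=> x; apply: inner_ext => h; rewrite !opE !opL !opZ.
  by rewrite !(inner_minus_l, inner_scal_l); inner_ring.
have -> : mult (minus S (op_scalar (a, b))) (minus S (op_scalar (a, - b))) =
    plus (mult W W) (scal (b ^ 2) op_one).
  apply: op_ext => x; apply: inner_ext => h; rewrite /W !opE !opL /rscal !opZ.
  by rewrite !(inner_minus_l, inner_plus_l, inner_scal_l); inner_ring.
have b2 : 0 < b ^ 2 by have := Rsqr_pos_lt b b0; rewrite /Rsqr; lra.
apply: (@coercive_invertible _ _ (b ^ 2)) => //.
  apply: symmetric_plus; last exact: symmetric_scal.
  exact: symmetric_mult.
move=> x; rewrite op_plusE op_multE op_scalE ip_plus_l sW ip_scal_l op_one'E.
by have := ip_ge0 (W x); lra.
Qed.

(** [s] is a sign: [1] excludes points strictly below the numerical range, [-1] points strictly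
    above it. *)
Lemma spectrum_not_coercive T (r s c : R) : symmetric T -> spectrum T (RtoC r) ->
  s ^ 2 = 1 -> 0 < c ->
  (forall x, c * ip x x <= s * (ip (T x) x - r * ip x x)) -> False.
Proof.
move=> sT sp s1 c0 coer; case: sp.
have ss : s * s = 1 by rewrite -s1; ring.
have [||B [BS SB]] := @coercive_invertible _ (scal s (minus T (scal r op_one))) c _ c0.
- by apply: symmetric_scal; apply: symmetric_minus => //; exact: symmetric_scal.
- by move=> x; rewrite !opE !ipE; exact: coer.
exists (scal s B).
have E x : (minus T (op_scalar (RtoC r))) x = rscal s (scal s (minus T (scal r op_one)) x).
  by apply: ip_ext => h; rewrite !opE -!/(rscal _ _) !ipE -Rmult_assoc ss Rmult_1_l.
split; apply: op_ext => x.
  rewrite op_multE E op_scalE opRZ -[B _]/((mult B (scal s (minus T (scal r op_one)))) x) BS.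
  by apply: ip_ext => h; rewrite !opE !ipE -Rmult_assoc ss Rmult_1_l.
rewrite op_multE [scal s B x]op_scalE opRZ E.
rewrite -[(scal s (minus T _)) (B x)]/((mult (scal s (minus T (scal r op_one))) B) x) SB.
by apply: ip_ext => h; rewrite !opE !ipE -Rmult_assoc ss Rmult_1_l.
Qed.

Lemma positive_spectrum P (r : R) : symmetric P -> op_nonneg P ->
  spectrum P (RtoC r) -> 0 <= r <= norm P.
Proof.
move=> sP pP sp; split; apply: Rnot_lt_le => lt.
  apply: (@spectrum_not_coercive P r 1 (- r)) => //; try lra.
  by move=> x; have := pP x; lra.
apply: (@spectrum_not_coercive P r (-1) (r - norm P)) => //; try lra.
move=> x; have /Rabs_le_between := ip_op_bound P x; rewrite -ip_norm; lra.
Qed.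

Lemma positive_spectrum_in P : symmetric P -> op_nonneg P ->
  spectrum_in (fun r : R => 0 <= r) P.
Proof.
move=> sP pP z sp; have e := spectrum_symmetric_real sP sp.
exists (Re z); split=> //; rewrite e in sp.
by have := positive_spectrum sP pP sp; lra.
Qed.

(** Both clauses are homogeneous in [x], so later arguments need no normalisation. *)
Lemma numerical_range_infimum S : (exists x : H, x <> zero) ->
  exists l, (forall x, l * ip x x <= ip (S x) x) /\
    (forall c, 0 < c -> ~ (forall x, (l + c) * ip x x <= ip (S x) x)).
Proof.
move=> [x0 x00].
have norm_pos x : x <> zero -> 0 < norm x.
  move=> xz; case: (norm_ge_0 x) => // e; case: xz; exact: norm_eq_zero.
have unit x : x <> zero -> norm (rscal (/ norm x) x) = 1.
  move=> /norm_pos n0; rewrite norm_rscal Rabs_pos_eq; first by field; lra.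
  by apply: Rlt_le; exact: Rinv_0_lt_compat.
pose J (t : {x : H | norm x = 1}) := ip (S (proj1_sig t)) (proj1_sig t).
have Jb t : - norm S <= J t.
  case: t => x n1; have /Rabs_le_between := ip_op_bound S x.
  by rewrite /J /= n1; lra.
have [l [lb gl]] := exists_infimum (exist _ _ (unit _ x00)) Jb.
exists l; split=> [x|c c0 h].
  case: (classic (x = zero)) => [->|xz]; first by rewrite op0 ip_zero_l; lra.
  have n0 := norm_pos _ xz.
  have := lb (exist _ _ (unit _ xz)); rewrite /J /= opRZ !ipE => h.
  have := Rmult_le_compat_r (norm x ^ 2) _ _ ltac:(nra) h.
  by rewrite ip_norm; have -> : / norm x * (/ norm x * ip (S x) x) * norm x ^ 2 =
    ip (S x) x by field; lra.
have [[x n1]] := gl c c0; rewrite /J /= => lt.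
by have := h x; rewrite ip_norm n1; lra.
Qed.

(** Cauchy-Schwarz for the form of [P] at [x] and [P x] gives [norm (P x) ^ 2 <= norm P * <Px, x>];
    with the lower bound [c] this yields the constant [c ^ 2 / norm P]. *)
Lemma positive_bounded_below_coercive P : symmetric P -> op_nonneg P -> bounded_below P ->
  (exists x : H, x <> zero) -> exists c, 0 < c /\ forall x, c * ip x x <= ip (P x) x.
Proof.
move=> sP pP [c [c0 hc]] [x0 x00].
have nP : 0 < norm P.
  have h1 := hc x0; have h2 := norm_op_apply P x0; have nP := norm_ge_0 P.
  have n0 : 0 < norm x0.
    case: (norm_ge_0 x0) => // e; case: x00; exact: norm_eq_zero.
  by apply: Rnot_le_lt => le; nra.
exists (c ^ 2 / norm P); split=> [|x]; first by apply: Rdiv_lt_0_compat => //; exact: pow_lt.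
apply: (Rmult_le_reg_l (norm P)) => //.
have -> : norm P * (c ^ 2 / norm P * ip x x) = (c * norm x) ^ 2.
  by rewrite ip_norm; field; lra.
apply: Rle_trans (_ : norm (P x) ^ 2 <= _).
  apply: pow_incr; split; last exact: hc.
  by apply: Rmult_le_pos; [lra | exact: norm_ge_0].
have h1 := positive_cauchy_schwarz x (P x) sP pP; rewrite ip_norm in h1.
have h2 : ip (P (P x)) (P x) <= norm P * norm (P x) ^ 2.
  by have /Rabs_le_between [] := ip_op_bound P (P x).
have p0 := pP x; have n0 := norm_ge_0 (P x).
set q := norm (P x) in h1 h2 n0 *; set p := ip (P x) x in h1 p0 *.
have h3 := Rmult_le_compat_l _ _ _ p0 h2.
case: (Req_dec q 0) => [->|q0].
  by rewrite /= Rmult_0_l; apply: Rmult_le_pos; lra.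
apply: (Rmult_le_reg_r (q ^ 2)); last lra.
by apply: pow_lt; lra.
Qed.

(** [S - l] is positive; were it bounded below it would be coercive, and [l] could be raised. *)
Lemma numerical_range_infimum_spectrum S l : symmetric S -> (exists x : H, x <> zero) ->
  (forall x, l * ip x x <= ip (S x) x) ->
  (forall c, 0 < c -> ~ (forall x, (l + c) * ip x x <= ip (S x) x)) ->
  ~ bounded_below (minus S (scal l op_one)).
Proof.
move=> sS H0 lb gl bb.
have [] := @positive_bounded_below_coercive (minus S (scal l op_one)) _ _ bb H0.
- by apply: symmetric_minus => //; exact: symmetric_scal.
- by move=> x; rewrite !opE !ipE; have := lb x; lra.
move=> c [c0 hc]; apply: (gl c c0) => x.
by have := hc x; rewrite !opE !ipE; lra.
Qed.

(** The bottom of the numerical range lies in the spectrum. *)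
Lemma spectrum_symmetric_nonempty T : symmetric T -> (exists x : H, x <> zero) ->
  exists r : R, spectrum T (RtoC r).
Proof.
move=> sT H0; have [l [lb gl]] := numerical_range_infimum T H0.
exists l => inv; apply: (numerical_range_infimum_spectrum sT H0 lb gl).
have [c [c0 hc]] := invertible_bounded_below inv.
by exists c.
Qed.

End Spectrum.

(** * Polynomials of a symmetric operator *)

(** Horner form, constant term first, so that evaluation at numbers and at operators obeys the same
    recursion. *)
Fixpoint poly_eval (l : list R) (x : R) : R :=
  match l with nil => 0 | a :: l' => a + x * poly_eval l' x end.

Fixpoint poly_op {H : HilbertSpace} (l : list R) (T : Op H) : Op H :=
  match l with nil => zero | a :: l' => plus (scal a op_one) (mult T (poly_op l' T)) end.

Fixpoint monic_op {H : HilbertSpace} (l : list C) (T : Op H) : Op H :=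
  match l with nil => one | c :: l' => plus (op_scalar c) (mult T (monic_op l' T)) end.

Fixpoint poly_add (l m : list R) : list R :=
  match l, m with
  | nil, _ => m
  | _, nil => l
  | a :: l', b :: m' => (a + b) :: poly_add l' m'
  end.

Definition poly_scal (r : R) (l : list R) : list R := map (Rmult r) l.

Fixpoint poly_mul (l m : list R) : list R :=
  match l with nil => nil | a :: l' => poly_add (poly_scal a m) (0 :: poly_mul l' m) end.

Lemma poly_eval_add l m x : poly_eval (poly_add l m) x = poly_eval l x + poly_eval m x.
Proof. by elim: l m => [|a l IH] [|b m] /=; rewrite ?IH; ring. Qed.

Lemma poly_eval_scal r l x : poly_eval (poly_scal r l) x = r * poly_eval l x.
Proof. by elim: l => [|a l IH] /=; rewrite ?IH; ring. Qed.

Lemma poly_eval_mul l m x : poly_eval (poly_mul l m) x = poly_eval l x * poly_eval m x.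
Proof.
by elim: l => [|a l IH] /=; rewrite ?poly_eval_add ?poly_eval_scal /= ?IH; ring.
Qed.

Section PolynomialCalculus.
Context {H : HilbertSpace}.
Implicit Types (x y z u h : H) (A B S T P : Op H).

Lemma poly_op_cons a l T u : poly_op (a :: l) T u = plus (rscal a u) (T (poly_op l T u)).
Proof. by []. Qed.

Lemma poly_op_nil T u : poly_op nil T u = zero.
Proof. by []. Qed.

Lemma poly_op_comm l T u : poly_op l T (T u) = T (poly_op l T u).
Proof.
elim: l => [|a l IH]; first by rewrite !poly_op_nil op0.
by rewrite !poly_op_cons IH !opL.
Qed.

Lemma poly_op_add l m T u :
  poly_op (poly_add l m) T u = plus (poly_op l T u) (poly_op m T u).
Proof.
elim: l m => [|a l IH] [|b m]; rewrite ?poly_op_nil ?plus_zero_l ?plus_zero_r //.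
rewrite [poly_add _ _]/= !poly_op_cons IH.
by apply: ip_ext => h; rewrite !opL !ipE; ring.
Qed.

Lemma poly_op_scal r l T u : poly_op (poly_scal r l) T u = rscal r (poly_op l T u).
Proof.
elim: l => [|a l IH]; apply: ip_ext => h.
  by rewrite !poly_op_nil !ipE; ring.
by rewrite [poly_scal _ _]/= !poly_op_cons IH !opL !ipE; ring.
Qed.

Lemma poly_op_mul l m T u : poly_op (poly_mul l m) T u = poly_op l T (poly_op m T u).
Proof.
elim: l => [|a l IH] //.
rewrite [poly_mul _ _]/= poly_op_add poly_op_scal !poly_op_cons IH.
by apply: ip_ext => h; rewrite !ipE; ring.
Qed.

Lemma poly_op_symmetric l T : symmetric T -> symmetric (poly_op l T).
Proof.
move=> sT; elim: l => [|a l IH] x y; first by rewrite !poly_op_nil !ipE.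
by rewrite !poly_op_cons !ipE sT IH poly_op_comm.
Qed.

Lemma poly_op_intertwine l A S T : (forall x, A (S x) = T (A x)) ->
  forall x, A (poly_op l S x) = poly_op l T (A x).
Proof.
move=> AST; elim: l => [|a l IH] x; first by rewrite !poly_op_nil op0.
by rewrite !poly_op_cons !opL AST IH.
Qed.

Lemma monic_eval_cons c l w :
  monic_eval (c :: l) w = Cplus c (Cmult w (monic_eval l w)).
Proof. by []. Qed.

Lemma monic_op_cons c l T u :
  monic_op (c :: l) T u = plus (scal c u) (T (monic_op l T u)).
Proof. by []. Qed.

(** Synthetic division by [w - z], with one quotient valid for numbers and operators alike. *)
Lemma monic_division (l : list C) (z : C) : l <> nil -> exists q : list C,
  length q = pred (length l) /\
  (forall w, monic_eval l w =
     Cplus (monic_eval l z) (Cmult (Cminus w z) (monic_eval q w))) /\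
  (forall T u, monic_op l T u =
     plus (scal (monic_eval l z) u) (minus T (op_scalar z) (monic_op q T u))).
Proof.
elim: l => [|c l IH] // _; case: (classic (l = nil)) => [->|l0].
  exists nil; split=> //; split=> [w|T u].
    rewrite !monic_eval_cons [monic_eval nil w]/= [monic_eval nil z]/=; ring.
  apply: inner_ext => h; rewrite !monic_op_cons monic_eval_cons !opE.
  rewrite !(inner_plus_l, inner_minus_l, inner_scal_l); inner_ring.
(* With [l(w) = l(z) + (w - z) q(w)], one gets [c + w l(w) = c + z l(z) + (w - z)(l(z) + w
   q(w))]. *)
have [q [lq [qe qo]]] := IH l0; exists (monic_eval l z :: q).
split; first by rewrite /= lq; case: (l) l0.
split=> [w|T u].
  rewrite !monic_eval_cons qe; ring.
rewrite !monic_op_cons monic_eval_cons qo; apply: inner_ext => h.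
rewrite !opE !opL !opZ !(inner_plus_l, inner_minus_l, inner_scal_l).
inner_ring.
Qed.

(** Each root lies off the spectrum, so each linear factor is bounded below, and lower bounds
    multiply under composition. *)
Lemma monic_op_bounded_below (l : list C) T :
  (forall z : C, spectrum T z -> monic_eval l z <> RtoC 0) -> bounded_below (monic_op l T).
Proof.
elim: (length l) {-2}l (eq_refl (length l)) => [|n IH] {}l.
  case: l => // _ _; exists 1; split=> [|x]; [lra | rewrite Rmult_1_l; exact: Rle_refl].
move=> ln nroot; have l0 : l <> nil by move=> e; rewrite e in ln.
have [z zr] := FundamentalTheoremOfAlgebra.monic_eval_root l0.
have [q [lq [qe qo]]] := monic_division z l0.
rewrite ln /= in lq; rewrite zr in qe qo.
have inv : invertible (minus T (op_scalar z)).
  by apply: NNPP => sp; exact: (nroot z sp).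
have [c [c0 hc]] := invertible_bounded_below inv.
have [w sw wr|d [d0 hd]] := IH q lq.
  by apply: (nroot w sw); rewrite qe wr; ring.
exists (c * d); split=> [|x]; first exact: Rmult_lt_0_compat.
have -> : monic_op l T x = minus T (op_scalar z) (monic_op q T x).
  by rewrite qo; apply: inner_ext => h; rewrite inner_plus_l inner_scal_l; ring.
apply: Rle_trans (hc _); have := Rmult_le_compat_l c _ _ ltac:(lra) (hd x); lra.
Qed.

(** A list may end in zeros, so the true leading coefficient [c] has to be found, or the polynomial
    vanishes. *)
Lemma poly_monic_or_zero (l : list R) :
  (forall x : R, poly_eval l x = 0) \/
  exists (c : R) (m : list C), c <> 0 /\
    (forall x : R, RtoC (poly_eval l x) = Cmult (RtoC c) (monic_eval m (RtoC x))) /\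
    (forall T u, poly_op l T u = rscal c (monic_op m T u)).
Proof.
(* The induction needs the vanishing of the operator polynomial too. *)
suff : ((forall x : R, poly_eval l x = 0) /\ (forall T u, poly_op l T u = zero)) \/
  exists (c : R) (m : list C), c <> 0 /\
    (forall x : R, RtoC (poly_eval l x) = Cmult (RtoC c) (monic_eval m (RtoC x))) /\
    (forall T u, poly_op l T u = rscal c (monic_op m T u)).
  by case=> [[]|]; [left | right].
elim: l => [|a l IH]; first by left.
case: IH => [[z1 z2]|[c [m [c0 [e1 e2]]]]].
  case: (Req_dec a 0) => [->|a0]; [left|right].
    split=> [x|T u]; first by rewrite /= z1; ring.
    by rewrite poly_op_cons z2 op0; apply: ip_ext => h; rewrite !ipE; ring.
  exists a, nil; split=> //; split=> [x|T u].
    by rewrite /= z1; congr pair => /=; ring.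
  by rewrite poly_op_cons z2 op0 plus_zero_r.
right; exists c, (RtoC (a / c) :: m); split=> //; split=> [x|T u].
  rewrite /= RtoC_plus RtoC_mult e1 RtoC_div //.
  by field => h; apply: c0; apply: RtoC_inj.
have E d : monic_op (d :: m) T u = plus (scal d u) (T (monic_op m T u)) by [].
rewrite poly_op_cons e2 E -/(rscal _ _); apply: ip_ext => h.
by rewrite !opL !ipE; field.
Qed.

(** The spectral mapping argument: a value of [poly_op l T] below [0] at the
    bottom of its numerical range would make [poly_eval l - lambda] vanish
    somewhere on the spectrum of [T]. *)
Lemma poly_op_positive (l : list R) T : symmetric T -> (exists x : H, x <> zero) ->
  (forall r : R, spectrum T (RtoC r) -> 0 <= poly_eval l r) -> op_nonneg (poly_op l T).
Proof.
move=> sT H0 pos.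
have [lam [lb gl]] := numerical_range_infimum (poly_op l T) H0.
case: (Rle_dec 0 lam) => [l0 x|l0].
  by have := lb x; have := ip_ge0 x; nra.
case: (numerical_range_infimum_spectrum (poly_op_symmetric l sT) H0 lb gl).
have ev r : poly_eval (poly_add l (- lam :: nil)) r = poly_eval l r - lam.
  by rewrite poly_eval_add /=; ring.
have op u : poly_op (poly_add l (- lam :: nil)) T u = minus (poly_op l T) (scal lam op_one) u.
  rewrite poly_op_add poly_op_cons poly_op_nil op0; apply: ip_ext => h.
  by rewrite !opE !ipE; ring.
(* The zero case would make [l] constantly [lam < 0], which a nonempty spectrum forbids; otherwise
   [l - lam] has no zero on the spectrum. *)
case: (poly_monic_or_zero (poly_add l (- lam :: nil))) => [z|[c [m [c0 [e1 e2]]]]].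
  have [r sr] := spectrum_symmetric_nonempty sT H0.
  by have := z r; rewrite ev; have := pos r sr; lra.
have [z sz mz|d [d0 hd]] := @monic_op_bounded_below m T.
  have zr := spectrum_symmetric_real sT sz; rewrite zr in sz mz.
  have := e1 (Re z); rewrite mz Cmult_0_r => /RtoC_inj.
  by rewrite ev; have := pos _ sz; lra.
exists (Rabs c * d); split=> [|x].
  by apply: Rmult_lt_0_compat => //; exact: Rabs_pos_lt.
rewrite -op e2 norm_rscal Rmult_assoc.
by apply: Rmult_le_compat_l; [exact: Rabs_pos | exact: hd].
Qed.

(** Positivity of the two polynomials [e + l] and [e - l], combined with the quadratic-form bound on
    the norm. *)
Lemma poly_op_norm_le (l : list R) T (e : R) : symmetric T -> (exists x : H, x <> zero) ->
  0 <= e -> (forall r : R, spectrum T (RtoC r) -> Rabs (poly_eval l r) <= e) ->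
  norm (poly_op l T) <= e.
Proof.
move=> sT H0 e0 le; apply: symmetric_norm_le => //; first exact: poly_op_symmetric.
have pos s : s ^ 2 = 1 -> forall x, 0 <= e * ip x x + s * ip (poly_op l T x) x.
  move=> s1 x.
  have := @poly_op_positive (poly_add (e :: nil) (poly_scal s l)) T sT H0 _ x.
  rewrite poly_op_add poly_op_scal poly_op_cons poly_op_nil op0 !ipE Rplus_0_r.
  apply=> r sr; rewrite poly_eval_add poly_eval_scal /=.
  have := le r sr; have := Rabs_mult s (poly_eval l r).
  have -> : Rabs s = 1 by have := pow2_abs s; rewrite s1; have := Rabs_pos s; nra.
  have := Rle_abs (- (s * poly_eval l r)); rewrite Rabs_Ropp; lra.
move=> x; apply/Rabs_le_between.
have := pos 1 ltac:(lra) x; have := pos (-1) ltac:(lra) x; lra.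
Qed.

End PolynomialCalculus.

(** * Weierstrass approximation *)

(** Expectation of [g] under the binomial law of parameters [n] and [x],
    by conditioning on one trial: this is the Bernstein polynomial. *)
Fixpoint bernstein (n : nat) (g : nat -> R) (x : R) : R :=
  match n with
  | O => g O
  | S n' => (1 - x) * bernstein n' g x + x * bernstein n' (fun k => g (S k)) x
  end.

Lemma bernstein_le n (g h : nat -> R) x : 0 <= x <= 1 ->
  (forall k, (k <= n)%nat -> g k <= h k) -> bernstein n g x <= bernstein n h x.
Proof.
move=> x01; elim: n g h => [|n IH] g h gh /=; first exact: gh.
have h1 : bernstein n g x <= bernstein n h x.
  by apply: IH => k kn; apply: gh; exact: le_S.
have h2 : bernstein n (fun k => g (S k)) x <= bernstein n (fun k => h (S k)) x.
  by apply: IH => k kn; apply: gh; exact: le_n_S.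
by apply: Rplus_le_compat; apply: Rmult_le_compat_l => //; lra.
Qed.

Lemma bernstein_ext n (g h : nat -> R) x : (forall k, g k = h k) ->
  bernstein n g x = bernstein n h x.
Proof.
move=> gh; elim: n g h gh => [|n IH] g h gh /=; first exact: gh.
by rewrite (IH g h gh) (IH _ (fun k => h (S k)) (fun k => gh (S k))).
Qed.

(** Second moment of the binomial law about [c]: variance plus squared bias. The centre is arbitrary
    because conditioning on a success shifts it to [c - 1]. *)
Lemma bernstein_variance n (a b c x : R) :
  bernstein n (fun k => a + b * (INR k - c) ^ 2) x =
  a + b * (INR n * x * (1 - x) + (INR n * x - c) ^ 2).
Proof.
elim: n a b c => [|n IH] a b c; first by rewrite /=; ring.
rewrite [bernstein _ _ _]/= IH.
rewrite (@bernstein_ext n _ (fun k => a + b * (INR k - (c - 1)) ^ 2)).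
  by rewrite IH (S_INR n); ring.
by move=> k; rewrite -/(INR (S k)) S_INR; ring.
Qed.

Fixpoint bernstein_poly (M : R) (n : nat) (g : nat -> R) : list R :=
  match n with
  | O => g O :: nil
  | S n' => poly_add (poly_mul (1 :: - / M :: nil) (bernstein_poly M n' g))
              (poly_mul (0 :: / M :: nil) (bernstein_poly M n' (fun k => g (S k))))
  end.

Lemma bernstein_poly_eval M n g x :
  poly_eval (bernstein_poly M n g) x = bernstein n g (x / M).
Proof.
elim: n g => [|n IH] g; first by rewrite /=; ring.
have -> : bernstein_poly M (S n) g =
  poly_add (poly_mul (1 :: - / M :: nil) (bernstein_poly M n g))
    (poly_mul (0 :: / M :: nil) (bernstein_poly M n (fun k => g (S k)))) by [].
by rewrite poly_eval_add !poly_eval_mul !IH /= /Rdiv; ring.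
Qed.

(** Uniform continuity handles close points; for distant ones [C] is the oscillation divided by
    [d ^ 2]. A quadratic bound can be averaged exactly by [bernstein_variance]. *)
Lemma quadratic_modulus (g : R -> R) e : continuity g -> 0 < e ->
  exists C, 0 <= C /\ forall x y, 0 <= x <= 1 -> 0 <= y <= 1 ->
    Rabs (g x - g y) <= e + C * (x - y) ^ 2.
Proof.
move=> cg e0.
have cg' x : 0 <= x <= 1 -> continuity_pt g x by move=> _; exact: cg.
have [d hd] := Heine_cor2 cg' (mkposreal _ e0).
have [x1 [ub _]] := continuity_ab_maj g 0 1 ltac:(lra) cg'.
have [x2 [lb _]] := continuity_ab_min g 0 1 ltac:(lra) cg'.
have d0 := cond_pos d; have d2 : 0 < d ^ 2 by exact: pow_lt.
have D0 : 0 <= g x1 - g x2 by have := ub x2; have := lb 0 ltac:(lra); have := ub 0 ltac:(lra); lra.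
exists ((g x1 - g x2) / d ^ 2); split=> [|x y hx hy]; first exact: Rdiv_le_0_compat.
have C0 : 0 <= (g x1 - g x2) / d ^ 2 by exact: Rdiv_le_0_compat.
case: (Rlt_dec (Rabs (x - y)) d) => xy.
  have h : Rabs (g x - g y) < e by exact: hd.
  by have := Rmult_le_pos _ _ C0 (pow2_ge_0 (x - y)); lra.
have : d ^ 2 <= (x - y) ^ 2.
  by rewrite -(pow2_abs (x - y)); apply: pow_incr; lra.
move=> h; have := Rmult_le_compat_l _ _ _ C0 h.
have -> : (g x1 - g x2) / d ^ 2 * d ^ 2 = g x1 - g x2 by field; lra.
have : Rabs (g x - g y) <= g x1 - g x2; last lra.
apply/Rabs_le_between.
have := ub x hx; have := ub y hy; have := lb x hx; have := lb y hy; lra.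
Qed.

(** Extending [f] by [f 0] on the left turns one-sided continuity at [0] into ordinary
    continuity. *)
Lemma continuous_on_extension (f : R -> R) (x : R) :
  continuous_on (fun x => 0 <= x) f -> continuity_pt (fun y => f (Rmax 0 y)) x.
Proof.
move=> cf; apply/continuity_pt_filterlim.
apply: (filterlim_comp _ _ _ (Rmax 0) f _ (within (fun x => 0 <= x) (locally (Rmax 0 x)))).
  have h : filterlim (Rmax 0) (locally x) (locally (Rmax 0 x)).
    move=> Q [e he]; exists e => y hy; apply: he; move: hy.
    rewrite /ball /= /AbsRing_ball /= /abs /minus /plus /opp /=.
    move=> /Rabs_lt_between h; apply/Rabs_lt_between; have := cond_pos e.
    by rewrite /Rmax; case: Rle_dec; case: Rle_dec => *; lra.
  move=> Q hQ.
  have h' : locally x (fun y => 0 <= Rmax 0 y -> Q (Rmax 0 y)) := h _ hQ.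
  apply: (filter_imp (F := locally x) (fun y => 0 <= Rmax 0 y -> Q (Rmax 0 y))) h'.
  by move=> y hy; apply: hy; exact: Rmax_l.
by apply: cf; exact: Rmax_l.
Qed.

Lemma weierstrass (f : R -> R) (M e : R) : continuous_on (fun x => 0 <= x) f ->
  0 <= M -> 0 < e ->
  exists l, forall x, 0 <= x <= M -> Rabs (f x - poly_eval l x) <= e.
Proof.
(* [N] is positive even when [M = 0], so [[0, M]] can be rescaled into [[0, 1]]. *)
move=> cf M0 e0; pose N := M + 1.
pose g t := f (Rmax 0 (N * t)).
have cg : continuity g.
  move=> t; apply: (continuity_pt_comp (fun t => N * t) (fun y => f (Rmax 0 y))).
    by apply: continuity_scal; exact: (derivable_continuous _ derivable_id).
  exact: continuous_on_extension.
have e2 : 0 < e / 2 by lra.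
have [C [C0 hC]] := quadratic_modulus cg e2.
have [n n1] : exists n, 2 * C / e + 1 < INR n.
  by have [n hn] := INR_unbounded (2 * C / e + 1); exists n; lra.
have n0 : 0 < INR n.
  have h : 0 <= 2 * C / e by apply: Rdiv_le_0_compat; lra.
  by lra.
have nC : C / INR n <= e / 2.
  apply: (Rmult_le_reg_r (INR n)) => //.
  have -> : C / INR n * INR n = C by field; lra.
  have := Rmult_lt_compat_r e _ _ e0 n1.
  have -> : (2 * C / e + 1) * e = 2 * C + e by field; lra.
  lra.
exists (bernstein_poly N n (fun k => g (INR k / INR n))) => x xM.
rewrite bernstein_poly_eval; set t := x / N.
have t01 : 0 <= t <= 1.
  split; first by apply: Rdiv_le_0_compat; rewrite /N; lra.
  by apply: (Rmult_le_reg_r N); rewrite /t /N /Rdiv ?Rmult_assoc ?Rinv_l; lra.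
have -> : f x = g t.
  rewrite /g /t; congr f; have -> : N * (x / N) = x by field; rewrite /N; lra.
  by rewrite Rmax_right //; lra.
(* The cases [s = 1] and [s = -1] average the upper and lower quadratic envelopes of [g] around
   [t]. *)
have V s : bernstein n (fun k => g t + s * e / 2 + s * C / INR n ^ 2 * (INR k - INR n * t) ^ 2) t
    = g t + s * (e / 2 + C / INR n * (t * (1 - t))).
  by rewrite bernstein_variance; field; lra.
have B : C / INR n * (t * (1 - t)) <= e / 2.
  have : 0 <= C / INR n by exact: Rdiv_le_0_compat.
  have : 0 <= t * (1 - t) <= 1 by nra.
  nra.
have K k : (k <= n)%nat ->
    Rabs (g (INR k / INR n) - g t) <= e / 2 + C / INR n ^ 2 * (INR k - INR n * t) ^ 2.
  move=> /le_INR kn.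
  have := hC (INR k / INR n) t _ t01.
  have -> : C * (INR k / INR n - t) ^ 2 = C / INR n ^ 2 * (INR k - INR n * t) ^ 2.
    by field; lra.
  apply; split; first by apply: Rdiv_le_0_compat => //; exact: pos_INR.
  by apply: (Rmult_le_reg_r (INR n)) => //; rewrite /Rdiv Rmult_assoc Rinv_l; lra.
have up : bernstein n (fun k => g (INR k / INR n)) t <=
    g t + 1 * (e / 2 + C / INR n * (t * (1 - t))).
  rewrite -V; apply: bernstein_le => // k /K /Rabs_le_between; rewrite /Rdiv; lra.
have lo : g t + -1 * (e / 2 + C / INR n * (t * (1 - t))) <=
    bernstein n (fun k => g (INR k / INR n)) t.
  rewrite -V; apply: bernstein_le => // k /K /Rabs_le_between; rewrite /Rdiv; lra.
apply/Rabs_le_between; lra.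
Qed.

(** * Passage between the power sums of [is_cfc] and coefficient lists *)

Lemma power_sum_recl (a : nat -> R) x n : sum_n (fun k => a k * x ^ k) (S n) =
  a O + x * sum_n (fun k => a (S k) * x ^ k) n.
Proof.
rewrite /sum_n sum_Sn_m; last exact: le_0_n.
rewrite -sum_n_m_S -[x * _]/(mult x _) -sum_n_m_mult_l /=.
rewrite /plus /= Rmult_1_r; congr Rplus; apply: sum_n_m_ext => k.
by rewrite /mult /=; ring.
Qed.

Lemma op_power_sum_recl (H : HilbertSpace) (a : nat -> R) (T : Op H) n :
  sum_n (fun k => scal (a k) (pow_n T k)) (S n) =
  plus (scal (a O) op_one) (mult T (sum_n (fun k => scal (a (S k)) (pow_n T k)) n)).
Proof.
rewrite /sum_n sum_Sn_m; last exact: le_0_n.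
rewrite -sum_n_m_S -sum_n_m_mult_l; congr plus.
by apply: sum_n_m_ext => k; apply: op_ext => u; rewrite !opE opRZ.
Qed.

Lemma power_sum_poly (n : nat) (a : nat -> R) : exists l : list R,
  (forall x, sum_n (fun k => a k * x ^ k) n = poly_eval l x) /\
  (forall (H : HilbertSpace) (T : Op H),
     sum_n (fun k => scal (a k) (pow_n T k)) n = poly_op l T).
Proof.
elim: n a => [|n IH] a.
  exists (a O :: nil); split=> [x|H T]; first by rewrite sum_O /=; ring.
  rewrite sum_O; apply: op_ext => u; rewrite poly_op_cons poly_op_nil op0.
  by apply: ip_ext => h; rewrite !opE !ipE; ring.
have [l [le lo]] := IH (fun k => a (S k)); exists (a O :: l).
by split=> [x|H T]; rewrite ?power_sum_recl ?op_power_sum_recl /= ?le ?lo.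
Qed.

Lemma poly_power_sum (l : list R) : exists (n : nat) (a : nat -> R),
  (forall x, sum_n (fun k => a k * x ^ k) n = poly_eval l x) /\
  (forall (H : HilbertSpace) (T : Op H),
     sum_n (fun k => scal (a k) (pow_n T k)) n = poly_op l T).
Proof.
elim: l => [|b l [n [a [ae ao]]]].
  exists O, (fun _ => 0); split=> [x|H T]; rewrite sum_O /=; first ring.
  by apply: op_ext => u; apply: ip_ext => h; rewrite !opE !ipE; ring.
exists (S n), (fun k => match k with O => b | S k' => a k' end).
by split=> [x|H T]; rewrite ?power_sum_recl ?op_power_sum_recl /= ?ae ?ao.
Qed.

(** * Continuous functional calculus *)

Section FunctionalCalculus.
Context {H : HilbertSpace}.
Hypothesis H_nonzero : exists x : H, x <> zero.
Implicit Types (x y z u h : H) (A B S T P : Op H) (r e : R) (f : R -> R).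

Lemma norm_minus_triangle A B S :
  norm (minus A S) <= norm (minus A B) + norm (minus B S).
Proof. by rewrite (minus_trans B A S); exact: norm_triangle. Qed.

Lemma op_norm_minusC A B : norm (minus A B) = norm (minus B A).
Proof. exact: op_norm_minus_sym. Qed.

Lemma norm_minus_apply A B x : norm (minus (A x) (B x)) <= norm (minus A B) * norm x.
Proof. exact: (norm_op_apply (minus A B) x). Qed.

Lemma ip_minus_apply A B x y :
  Rabs (ip (A x) y - ip (B x) y) <= norm (minus A B) * norm x * norm y.
Proof.
rewrite -ip_minus_l; apply: Rle_trans (Rabs_ip_le _ _) _.
by apply: Rmult_le_compat_r; [exact: norm_ge_0 | exact: norm_minus_apply].
Qed.

(** The cap [e <= 1] allows quadratic errors to be absorbed into linear ones. *)
Lemma vanishing_bound (a K : R) : 0 <= K -> (forall e, 0 < e -> e <= 1 -> a <= e * K) -> a <= 0.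
Proof.
move=> K0 h; apply: Rnot_lt_le => a0.
have d0 : 0 < a / 2 / (K + 1) by apply: Rdiv_lt_0_compat; lra.
have := h (Rmin 1 (a / 2 / (K + 1))) (Rmin_pos _ _ Rlt_0_1 d0) (Rmin_l _ _).
have := Rmult_le_compat_r K _ _ K0 (Rmin_r 1 (a / 2 / (K + 1))).
have : a / 2 / (K + 1) * K <= a / 2 / (K + 1) * (K + 1).
  by apply: Rmult_le_compat_l; lra.
have -> : a / 2 / (K + 1) * (K + 1) = a / 2 by field; lra.
lra.
Qed.

Lemma norm_eq_of_vanishing x y (K : R) : 0 <= K ->
  (forall e, 0 < e -> e <= 1 -> norm (minus x y) <= e * K) -> x = y.
Proof.
move=> K0 h; apply: minus_eq0; apply: norm_eq_zero.
apply: Rle_antisym; [exact: vanishing_bound h | exact: norm_ge_0].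
Qed.

Lemma is_cfc_poly f T S : is_cfc f T S <-> forall e, 0 < e -> exists l,
  (forall r, spectrum T (RtoC r) -> Rabs (f r - poly_eval l r) < e) /\
  norm (minus S (poly_op l T)) < e.
Proof.
split=> [h e e0|h eps].
  have [n [a [h1 h2]]] := h (mkposreal _ e0).
  have [l [le lo]] := power_sum_poly n a; exists l.
  by split=> [r sr|]; [rewrite -le; exact: h1 | rewrite -lo].
have [l [h1 h2]] := h eps (cond_pos eps).
have [n [a [le lo]]] := poly_power_sum l; exists n, a.
by split=> [r sr|]; [rewrite le; exact: h1 | rewrite lo].
Qed.

Lemma poly_op_dist (l m : list R) T e : symmetric T -> 0 <= e ->
  (forall r, spectrum T (RtoC r) -> Rabs (poly_eval l r - poly_eval m r) <= e) ->
  norm (minus (poly_op l T) (poly_op m T)) <= e.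
Proof.
move=> sT e0 h.
have -> : minus (poly_op l T) (poly_op m T) = poly_op (poly_add l (poly_scal (-1) m)) T.
  apply: op_ext => x; rewrite poly_op_add poly_op_scal; apply: ip_ext => y.
  by rewrite !opE !ipE; ring.
apply: poly_op_norm_le => // r sr; rewrite poly_eval_add poly_eval_scal.
by have := h r sr; congr (_ <= _); congr Rabs; ring.
Qed.

(** Any polynomial close to [f] on the spectrum is close to [f(T)], not just those supplied by
    [is_cfc]: compare it with one of them. *)
Lemma is_cfc_dist f T S (l : list R) e : symmetric T -> 0 <= e -> is_cfc f T S ->
  (forall r, spectrum T (RtoC r) -> Rabs (f r - poly_eval l r) <= e) ->
  norm (minus S (poly_op l T)) <= e.
Proof.
move=> sT e0 /is_cfc_poly cS h; apply: le_epsilon => d d0.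
have d2 : 0 < d / 2 by lra.
have [m [h1 h2]] := cS _ d2.
have := norm_minus_triangle S (poly_op m T) (poly_op l T).
have : norm (minus (poly_op m T) (poly_op l T)) <= d / 2 + e; last lra.
apply: poly_op_dist => //; first lra.
move=> r sr; have := h1 r sr; have := h r sr.
have := Rabs_triang (- (f r - poly_eval m r)) (f r - poly_eval l r).
rewrite Rabs_Ropp; have -> : - (f r - poly_eval m r) + (f r - poly_eval l r) =
  poly_eval m r - poly_eval l r by ring.
lra.
Qed.

Lemma is_cfc_unique f T S S' : symmetric T -> is_cfc f T S -> is_cfc f T S' -> S = S'.
Proof.
move=> sT cS /is_cfc_poly cS'; apply: op_ext => x.
apply: (@norm_eq_of_vanishing _ _ (2 * norm x)).
  by have := norm_ge_0 x; lra.
move=> e e0 _; have [l [h1 h2]] := cS' e e0.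
have h3 : norm (minus S (poly_op l T)) <= e.
  by apply: (is_cfc_dist sT _ cS) => [|r sr]; [lra | apply: Rlt_le; exact: h1].
have := norm_minus_triangle S (poly_op l T) S'; rewrite (op_norm_minusC (poly_op l T) S').
move=> h4; have h5 : norm (minus S S') <= 2 * e by lra.
have := norm_minus_apply S S' x.
have := Rmult_le_compat_r _ _ _ (norm_ge_0 x) h5; lra.
Qed.

Lemma cfc_eq f T S : symmetric T -> is_cfc f T S -> cfc f T = S.
Proof.
move=> sT cS; apply: (is_cfc_unique sT _ cS).
exact: (epsilon_spec (inhabits op_zero) (is_cfc f T) (ex_intro _ S cS)).
Qed.

(** Existence: the polynomials near [f] on [[0, norm P]], an interval containing the spectrum, give
    a Cauchy filter of operators. *)
Lemma is_cfc_cfc f P : continuous_on (fun r => 0 <= r) f -> symmetric P -> op_nonneg P ->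
  is_cfc f P (cfc f P).
Proof.
move=> cf sP pP.
apply: (epsilon_spec (inhabits op_zero) (is_cfc f P)).
pose near l e := forall r, 0 <= r <= norm P -> Rabs (f r - poly_eval l r) <= e.
have W e : 0 < e -> exists l, near l e.
  by move=> e0; apply: weierstrass => //; exact: norm_ge_0.
pose F (Q : Op H -> Prop) := exists e, 0 < e /\ forall l, near l e -> Q (poly_op l P).
have PF : ProperFilter F.
  split=> [Q [e [e0 hQ]]|]; first by have [l /hQ ?] := W e e0; exists (poly_op l P).
  split.
  - by exists 1; split=> //; lra.
  - move=> Q Q' [e [e0 hQ]] [d [d0 hQ']]; exists (Rmin e d).
    split=> [|l hl]; first exact: Rmin_pos.
    have := Rmin_l e d; have := Rmin_r e d => ? ?.
    by split; [apply: hQ | apply: hQ'] => r /hl ?; lra.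
  - by move=> Q Q' QQ [e [e0 hQ]]; exists e; split=> // l /hQ; exact: QQ.
have cF : cauchy F.
  move=> eps; have ep := cond_pos eps; have e3 : 0 < eps / 3 by lra.
  have [l hl] := W _ e3; exists (poly_op l P), (eps / 3); split=> // m hm.
  have : norm (minus (poly_op m P) (poly_op l P)) <= 2 * (eps / 3).
    apply: poly_op_dist => //; first lra.
    move=> r /(positive_spectrum sP pP) hr; have := hl r hr; have := hm r hr.
    have := Rabs_triang (- (f r - poly_eval m r)) (f r - poly_eval l r).
    rewrite Rabs_Ropp; have -> : - (f r - poly_eval m r) + (f r - poly_eval l r) =
      poly_eval m r - poly_eval l r by ring.
    lra.
  move=> h; have : norm (minus (poly_op m P) (poly_op l P)) < eps by lra.
  by [].
exists (lim F); apply/is_cfc_poly => e e0.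
have [d [d0 hd]] := complete_cauchy _ PF cF (mkposreal _ e0).
have e2 : 0 < e / 2 by lra.
have [l hl] := W _ (Rmin_pos _ _ d0 e2); exists l.
have := Rmin_l d (e / 2); have := Rmin_r d (e / 2) => m1 m2.
split=> [r /(positive_spectrum sP pP) /hl|]; first lra.
rewrite op_norm_minusC; apply: (hd l) => r /hl; lra.
Qed.

(** If [m] is within [e] of [f], then [m + e - l] is nonnegative on the spectrum. The empty list
    gives positivity of [f(T)], a line gives Jensen. *)
Lemma is_cfc_lower_bound f T S (l : list R) : symmetric T -> is_cfc f T S ->
  (forall r, spectrum T (RtoC r) -> poly_eval l r <= f r) ->
  forall x, ip (poly_op l T x) x <= ip (S x) x.
Proof.
move=> sT /is_cfc_poly cS h x.
suff : ip (poly_op l T x) x - ip (S x) x <= 0 by lra.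
apply: (@vanishing_bound _ (2 * norm x ^ 2)); first by have := pow2_ge_0 (norm x); lra.
move=> e e0 _; have [m [h1 h2]] := cS e e0.
have : 0 <= ip (poly_op (poly_add (e :: nil) (poly_add m (poly_scal (-1) l))) T x) x.
  apply: poly_op_positive => // r sr.
  rewrite !poly_eval_add poly_eval_scal /=.
  have := h r sr; have /Rabs_lt_between := h1 r sr; lra.
rewrite !poly_op_add poly_op_scal poly_op_cons poly_op_nil op0 !ipE ip_norm.
have /Rabs_le_between := ip_minus_apply S (poly_op m T) x x.
have : norm (minus S (poly_op m T)) * norm x * norm x <= e * norm x ^ 2.
  rewrite Rmult_assoc; have -> : norm x * norm x = norm x ^ 2 by ring.
  by apply: Rmult_le_compat_r; [exact: pow2_ge_0 | lra].
lra.
Qed.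

Lemma is_cfc_symmetric f T S : symmetric T -> is_cfc f T S -> symmetric S.
Proof.
move=> sT /is_cfc_poly cS x y.
suff : Rabs (ip (S x) y - ip x (S y)) <= 0.
  by have := Rabs_pos (ip (S x) y - ip x (S y)); split_Rabs; lra.
have n0 : 0 <= norm x * norm y by apply: Rmult_le_pos; exact: norm_ge_0.
apply: (@vanishing_bound _ (2 * (norm x * norm y))); first lra.
move=> e e0 _; have [l [_ h]] := cS e e0.
have /Rabs_le_between h1 := ip_minus_apply S (poly_op l T) x y.
have /Rabs_le_between h2 := ip_minus_apply S (poly_op l T) y x.
have sl := poly_op_symmetric l sT x y.
rewrite (ip_sym x (poly_op l T y)) in sl.
have := Rmult_le_compat_r _ _ _ n0 (Rlt_le _ _ h) => h3.
by apply/Rabs_le_between; rewrite (ip_sym x (S y)); lra.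
Qed.

Lemma cfc_const_op f r : is_cfc f (scal r op_one : Op H) (scal (f r) op_one).
Proof.
apply/is_cfc_poly => e e0; exists (f r :: nil); split=> [s ss|].
  have -> : s = r.
    apply: NNPP => sr; case: ss; exists (scal (/ (r - s)) op_one).
    by split; apply: op_ext => x; apply: ip_ext => h;
      rewrite !opE -!/(rscal _ _) !ipE; field; lra.
  by rewrite /= Rmult_0_r Rplus_0_r Rminus_diag Rabs_R0.
have -> : minus (scal (f r) op_one) (poly_op (f r :: nil) (scal r op_one)) = zero :> Op H.
  by apply: op_ext => x; apply: ip_ext => h;
    rewrite op_minusE poly_op_cons poly_op_nil op0 !opE !ipE; ring.
by rewrite norm_zero.
Qed.

End FunctionalCalculus.

(** * Absolute values and the mixed Schwarz inequality *)

Section AbsoluteValue.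
Context {H : HilbertSpace}.
Hypothesis H_nonzero : exists x : H, x <> zero.
Implicit Types (x y z u h : H) (A B C S T P : Op H).

Lemma op_norm_mult A B : norm (mult A B) <= norm A * norm B.
Proof.
apply: op_norm_le => [|x]; first by apply: Rmult_le_pos; exact: norm_ge_0.
rewrite opE; apply: Rle_trans (norm_op_apply A _) _; rewrite Rmult_assoc.
by apply: Rmult_le_compat_l; [exact: norm_ge_0 | exact: norm_op_apply].
Qed.

Lemma adjoint_mult_symmetric A : symmetric (mult (adjoint A) A).
Proof. by move=> x y; rewrite !opE -adjoint_ip ip_sym -adjoint_ip ip_sym. Qed.

Lemma adjoint_mult_ip A x : ip (mult (adjoint A) A x) x = norm (A x) ^ 2.
Proof. by rewrite opE ip_sym -adjoint_ip ip_norm. Qed.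

Lemma adjoint_mult_nonneg A : op_nonneg (mult (adjoint A) A).
Proof. by move=> x; rewrite adjoint_mult_ip; exact: pow2_ge_0. Qed.

Lemma sqrt_continuous_on : continuous_on (fun r => 0 <= r) sqrt.
Proof.
move=> r _; apply: (filterlim_filter_le_1 _ _ (continuous_sqrt r)).
exact: filter_le_within.
Qed.

Lemma op_abs_is_cfc A : is_cfc sqrt (mult (adjoint A) A) (op_abs A).
Proof.
apply: is_cfc_cfc => //; [exact: sqrt_continuous_on |
  exact: adjoint_mult_symmetric | exact: adjoint_mult_nonneg].
Qed.

Lemma op_abs_symmetric A : symmetric (op_abs A).
Proof. exact: is_cfc_symmetric (@adjoint_mult_symmetric A) (op_abs_is_cfc A). Qed.

Lemma op_abs_nonneg A : op_nonneg (op_abs A).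
Proof.
move=> x; have := @is_cfc_lower_bound _ H_nonzero _ _ _ nil
  (@adjoint_mult_symmetric A) (op_abs_is_cfc A) (fun r _ => sqrt_pos r) x.
by rewrite poly_op_nil ip_zero_l.
Qed.

(** One polynomial serves every [A] below the norm bound; the intertwining relation needs the same
    one for [A] and its adjoint. *)
Lemma sqrt_polynomial (M e : R) : 0 <= M -> 0 < e -> exists l,
  (forall r, 0 <= r <= M -> Rabs (sqrt r - poly_eval l r) <= e) /\
  forall A, norm (mult (adjoint A) A) <= M ->
    norm (minus (op_abs A) (poly_op l (mult (adjoint A) A))) <= e.
Proof.
move=> M0 e0; have [l hl] := weierstrass sqrt_continuous_on M0 e0.
exists l; split=> // A AM; apply: (is_cfc_dist H_nonzero _ _ (op_abs_is_cfc A)).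
- exact: adjoint_mult_symmetric.
- lra.
- move=> r sr; apply: hl.
  by have := positive_spectrum (@adjoint_mult_symmetric A) (@adjoint_mult_nonneg A) sr; lra.
Qed.

Lemma op_abs_sqr A x : op_abs A (op_abs A x) = adjoint A (A x).
Proof.
set P := mult (adjoint A) A; set B := op_abs A.
have nP : 0 <= norm P by exact: norm_ge_0.
have nB : 0 <= norm B by exact: norm_ge_0.
(* For [p] near [B], write [B^2 - P = B (B - p) + (B - p) p + (p^2 - P)], with
   [norm p <= norm B + 1]. The last term uses [q^2 - s^2 = (q - s)(q + s)] on the spectrum. *)
pose K := 2 * norm B + 1 + (2 * sqrt (norm P) + 1).
have K0 : 0 <= K by have := sqrt_pos (norm P); rewrite /K; lra.
apply: (@norm_eq_of_vanishing _ _ _ (K * norm x)).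
  by apply: Rmult_le_pos => //; exact: norm_ge_0.
move=> e e0 e1; have [l [h1 h2]] := sqrt_polynomial nP e0.
have {}h2 : norm (minus B (poly_op l P)) <= e by apply: h2; exact: Rle_refl.
set p := poly_op l P in h2.
have pp : norm (minus (mult p p) P) <= e * (2 * sqrt (norm P) + 1).
  have -> : minus (mult p p) P =
      minus (poly_op (poly_mul l l) P) (poly_op (0 :: 1 :: nil) P).
    apply: op_ext => y; apply: ip_ext => h.
    rewrite /p !op_minusE [mult (poly_op l P) _ y]op_multE poly_op_mul.
    by rewrite !poly_op_cons poly_op_nil !opL !ipE; ring.
  have sq : 0 <= sqrt (norm P) by exact: sqrt_pos.
  apply: (poly_op_dist H_nonzero) => //.
  - exact: adjoint_mult_symmetric.
  - by apply: Rmult_le_pos; lra.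
  - move=> r sr; rewrite poly_eval_mul /=.
    have rP := positive_spectrum (@adjoint_mult_symmetric A) (@adjoint_mult_nonneg A) sr.
    have /Rabs_le_between hr := h1 r rP.
    have := sqrt_sqrt r (proj1 rP); have := sqrt_pos r; have := sqrt_le_1_alt _ _ (proj2 rP).
    set s := sqrt r in hr *; set q := poly_eval l r in hr *; set t := sqrt (norm P) in sq *.
    rewrite -/P -/t => st s0 sE.
    have -> : q * q - (0 + r * (1 + r * 0)) = (q - s) * (q + s) by rewrite -sE; ring.
    rewrite Rabs_mult; apply: Rmult_le_compat; try exact: Rabs_pos.
      by apply/Rabs_le_between; lra.
    by apply/Rabs_le_between; lra.
have -> : minus (B (B x)) (adjoint A (A x)) =
    plus (plus (B (minus B p x)) (minus B p (p x))) (minus (mult p p) P x).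
  by apply: ip_ext => h; rewrite /P !opE !opL !ipE; ring.
have np : norm p <= norm B + 1.
  have := norm_minus_triangle p B zero; rewrite (op_norm_minusC p B) !minus_zero_r; lra.
have nx := norm_ge_0 x.
have t1 : norm (B (minus B p x)) <= norm B * (e * norm x).
  apply: Rle_trans (norm_op_apply _ _) _; apply: Rmult_le_compat_l => //.
  apply: Rle_trans (norm_op_apply _ _) _; exact: Rmult_le_compat_r.
have t2 : norm (minus B p (p x)) <= e * ((norm B + 1) * norm x).
  apply: Rle_trans (norm_op_apply _ _) _.
  apply: Rmult_le_compat => //; try exact: norm_ge_0.
  apply: Rle_trans (norm_op_apply _ _) _; exact: Rmult_le_compat_r.
have t3 : norm (minus (mult p p) P x) <= e * (2 * sqrt (norm P) + 1) * norm x.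
  apply: Rle_trans (norm_op_apply _ _) _; exact: Rmult_le_compat_r.
apply: Rle_trans (norm_triangle _ _) _.
have t12 := Rle_trans _ _ _ (norm_triangle _ _) (Rplus_le_compat _ _ _ _ t1 t2).
apply: Rle_trans (Rplus_le_compat _ _ _ _ t12 t3) _.
by right; rewrite /K; ring.
Qed.

(** [A] intertwines [adjoint A] times [A] with [A] times [adjoint A], hence every polynomial in
    them, hence their square roots. *)
Lemma op_abs_intertwine A x : A (op_abs A x) = op_abs (adjoint A) (A x).
Proof.
set P := mult (adjoint A) A; set Q := mult (adjoint (adjoint A)) (adjoint A).
pose M := norm P + norm Q.
have nP : 0 <= norm P by exact: norm_ge_0.
have nQ : 0 <= norm Q by exact: norm_ge_0.
have nA : 0 <= norm A by exact: norm_ge_0.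
have nx := norm_ge_0 x.
apply: (@norm_eq_of_vanishing _ _ _ (2 * (norm A * norm x))).
  by have := Rmult_le_pos _ _ nA nx; lra.
move=> e e0 _; have [l [_ hl]] := @sqrt_polynomial M e ltac:(rewrite /M; lra) e0.
have h1 : norm (minus (op_abs A) (poly_op l P)) <= e by apply: hl; rewrite /M /P; lra.
have h2 : norm (minus (op_abs (adjoint A)) (poly_op l Q)) <= e.
  by apply: hl; rewrite -/Q /M; lra.
have -> : minus (A (op_abs A x)) (op_abs (adjoint A) (A x)) =
    minus (A (minus (op_abs A) (poly_op l P) x))
      (minus (op_abs (adjoint A)) (poly_op l Q) (A x)).
  have e1 : A (poly_op l P x) = poly_op l Q (A x).
    by apply: poly_op_intertwine => y; rewrite /P /Q !opE adjointK.
  by apply: ip_ext => h; rewrite !op_minusE !opL !ipE e1; ring.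
apply: Rle_trans (norm_triangle _ _) _; rewrite norm_opp.
have t1 : norm (A (minus (op_abs A) (poly_op l P) x)) <= norm A * (e * norm x).
  apply: Rle_trans (norm_op_apply _ _) _; apply: Rmult_le_compat_l => //.
  apply: Rle_trans (norm_op_apply _ _) _; exact: Rmult_le_compat_r.
have t2 : norm (minus (op_abs (adjoint A)) (poly_op l Q) (A x)) <= e * (norm A * norm x).
  apply: Rle_trans (norm_op_apply _ _) _.
  by apply: Rmult_le_compat => //; try exact: norm_ge_0; exact: norm_op_apply.
apply: Rle_trans (Rplus_le_compat _ _ _ _ t1 t2) _.
by right; ring.
Qed.

Lemma am_gm (a b t : R) : 0 <= a -> 0 <= b -> t ^ 2 <= a * b -> t <= / 2 * (a + b).
Proof.
move=> a0 b0 h; apply: Rnot_lt_le => lt; set m := / 2 * (a + b) in lt.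
have := Rmult_lt_0_compat (t - m) (t + m) ltac:(lra) ltac:(rewrite /m; rewrite /m in lt; lra).
have := pow2_ge_0 (a - b); rewrite /m; lra.
Qed.

(** With [(|A*| + e) u = y] and [z = A* u] one has [A* y = (|A| + e) z], so the
    inequality is Cauchy-Schwarz for the form of [|A| + e], followed by AM-GM. *)
Lemma mixed_schwarz A x y :
  ip (A x) y <= / 2 * (ip (op_abs A x) x + ip (op_abs (adjoint A) y) y).
Proof.
set B := op_abs A; set C := op_abs (adjoint A).
have sB : symmetric B := @op_abs_symmetric A.
have pB : op_nonneg B := @op_abs_nonneg A.
have sC : symmetric C := @op_abs_symmetric (adjoint A).
have pC : op_nonneg C := @op_abs_nonneg (adjoint A).
have BC u : B (adjoint A u) = adjoint A (C u).
  by rewrite /C op_abs_intertwine adjointK.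
have CC u : C (C u) = A (adjoint A u) by rewrite /C op_abs_sqr adjointK.
have x0 := ip_ge0 x.
suff : ip (A x) y - / 2 * (ip (B x) x + ip (C y) y) <= 0 by lra.
apply: (@vanishing_bound _ (/ 2 * ip x x)); first lra.
(* The error [e / 2 * ip x x] comes from replacing [B] by [B + e] in the form at [x]. *)
move=> e e0 _.
have sCe : symmetric (plus C (scal e op_one)).
  by apply: symmetric_plus => //; exact: symmetric_scal.
(* [C] need not be onto; adding [e] makes it coercive. *)
have [u uy] : exists u, plus C (scal e op_one) u = y.
  apply: (@coercive_onto _ _ e) => // v.
  by rewrite !opE !ipE; have := pC v; lra.
rewrite !opE in uy.
set z := adjoint A u.
have Ayz : adjoint A y = plus (B z) (rscal e z) by rewrite -uy !opL -BC.
have -> : ip (A x) y = ip (plus (B x) (rscal e x)) z.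
  by rewrite adjoint_ip Ayz !ipE sB.
have sBe : symmetric (plus B (scal e op_one)).
  by apply: symmetric_plus => //; exact: symmetric_scal.
have pBe : op_nonneg (plus B (scal e op_one)).
  by move=> v; rewrite !opE !ipE; have := pB v; have := ip_ge0 v; nra.
have := positive_cauchy_schwarz x z sBe pBe; have := pBe x; have := pBe z.
rewrite !opE.
(* The left side equals [<y, C C u>], and the right side exceeds it by
   [e |C u|^2 + e^2 <C u, u>]. *)
have zE : ip (plus (B z) (rscal e z)) z <= ip (C y) y.
  have E : ip (adjoint A y) z = ip y (C (C u)) by rewrite CC ip_sym -adjoint_ip ip_sym.
  rewrite -Ayz E -uy !opL !ipE.
  have h1 := ip_ge0 (C u); have h2 := pC u.
  have e1 := sC (C u) (C u); have e2 := sC (C u) u; have e3 := sC u (C u).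
  have h3 := Rmult_le_pos _ _ (Rlt_le _ _ e0) h1.
  have h4 := Rmult_le_pos _ _ (Rlt_le _ _ e0) (Rmult_le_pos _ _ (Rlt_le _ _ e0) h2).
  rewrite e1 e2 -e3; lra.
set t := ip (plus (B x) _) z; set a := ip _ x; set b := ip _ z in zE *.
have aE : a = ip (B x) x + e * ip x x by rewrite /a !ipE.
move=> b0 a0 h.
have : t <= / 2 * (a + b); last lra.
exact: am_gm.
Qed.

(** The inner product is conjugate linear on the right, so the phase is [c / |c|] for
    [c = inner x y], and [1] when [c = 0]. *)
Lemma inner_phase x y :
  exists v : C, Cmod v = 1 /\ ip x (scal v y) = Cmod (inner x y).
Proof.
set c := inner x y.
case: (Req_dec (Cmod c) 0) => [c0|c0].
  exists (RtoC 1); split; first exact: Cmod_1.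
  by rewrite (scal_one (K := C_Ring)) /ip -/c c0 (Cmod_eq_0 _ c0).
have rc0 : RtoC (Cmod c) <> RtoC 0 by move=> /RtoC_inj.
exists (Cdiv c (RtoC (Cmod c))); split.
  by rewrite Cmod_div // Cmod_R Rabs_pos_eq; [field | exact: Cmod_ge_0].
rewrite /ip inner_scal_r -/c Cdiv_conj //.
have -> : Cconj (RtoC (Cmod c)) = RtoC (Cmod c) by rewrite /Cconj /= Ropp_0.
have -> : Cmult (Cdiv (Cconj c) (RtoC (Cmod c))) c =
  Cdiv (Cmult c (Cconj c)) (RtoC (Cmod c)) by field.
rewrite -Cmod2_conj RtoC_pow.
by have -> : Cdiv (Cpow (RtoC (Cmod c)) 2) (RtoC (Cmod c)) = RtoC (Cmod c) by field.
Qed.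

Lemma Cmod_inner_le x y : Cmod (inner x y) <= norm x * norm y.
Proof.
have [v [v1 <-]] := inner_phase x y.
by apply: Rle_trans (ip_le_norm _ _) _; rewrite norm_Cscal v1 Rmult_1_l; exact: Rle_refl.
Qed.

(** Mixed Schwarz at [x] and a unimodular multiple of [x]; the phase drops out of the quadratic form
    on the right. *)
Lemma numerical_radius_bound A x : Cmod (inner (A x) x) <=
  ip (scal (/ 2) (plus (op_abs A) (op_abs (adjoint A))) x) x.
Proof.
have [v [v1 <-]] := inner_phase (A x) x.
rewrite !opE !ipE; have := mixed_schwarz A x (scal v x).
have -> : ip (op_abs (adjoint A) (scal v x)) (scal v x) = ip (op_abs (adjoint A) x) x.
  rewrite opZ ip_Cscal scal_assoc /mult /= Cmult_comm -Cmod2_conj v1 pow1.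
  by rewrite (scal_one (K := C_Ring)).
by [].
Qed.

End AbsoluteValue.

(** * The Hermite-Hadamard chain *)

Lemma Rmax_lipschitz c x y : Rabs (Rmax c x - Rmax c y) <= Rabs (x - y).
Proof.
by rewrite /Rmax; case: (Rle_dec c x) => ?; case: (Rle_dec c y) => ?; split_Rabs; lra.
Qed.

Lemma Rmin_lipschitz c x y : Rabs (Rmin c x - Rmin c y) <= Rabs (x - y).
Proof.
by rewrite /Rmin; case: (Rle_dec c x) => ?; case: (Rle_dec c y) => ?; split_Rabs; lra.
Qed.

(** [c] is the left derivative at [a], the supremum of the slopes of chords from the left; each
    chord to the right is at least as steep. Monotonicity makes it nonnegative. *)
Lemma convex_support_line (f : R -> R) (a : R) :
  (forall s r t, 0 <= s -> 0 <= r -> 0 <= t <= 1 ->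
     f ((1 - t) * s + t * r) <= (1 - t) * f s + t * f r) ->
  (forall x y, 0 <= x -> x <= y -> f x <= f y) -> 0 <= a ->
  exists c, 0 <= c /\ forall y, 0 <= y -> f a + c * (y - a) <= f y.
Proof.
(* At [0] there is no chord from the left, and the horizontal line works. *)
move=> conv mono a0; case: (Req_dec a 0) => [->|az].
  by exists 0; split=> [|y y0]; [lra | have := mono 0 y ltac:(lra) y0; lra].
pose slope s := (f a - f s) / (a - s).
have slopeE s : s < a -> slope s * (a - s) = f a - f s.
  by move=> sa; rewrite /slope; field; lra.
have ub s y : 0 <= s -> s < a -> a < y -> slope s <= (f y - f a) / (y - a).
  move=> s0 sa ay.
  have t01 : 0 <= (a - s) / (y - s) <= 1.
    split; first by apply: Rdiv_le_0_compat; lra.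
    by apply: (Rmult_le_reg_r (y - s)); rewrite /Rdiv ?Rmult_assoc ?Rinv_l; lra.
  have := conv s y _ s0 ltac:(lra) t01.
  have -> : (1 - (a - s) / (y - s)) * s + (a - s) / (y - s) * y = a by field; lra.
  move=> h; have := Rmult_le_compat_r (y - s) _ _ ltac:(lra) h.
  have -> : ((1 - (a - s) / (y - s)) * f s + (a - s) / (y - s) * f y) * (y - s) =
    (y - a) * f s + (a - s) * f y by field; lra.
  move=> h'; apply: (Rmult_le_reg_r ((a - s) * (y - a))).
    by apply: Rmult_lt_0_compat; lra.
  have -> : (f y - f a) / (y - a) * ((a - s) * (y - a)) = (f y - f a) * (a - s).
    by field; lra.
  rewrite -Rmult_assoc slopeE //; lra.
have [|| c [cub club]] := completeness (fun r => exists s, 0 <= s /\ s < a /\ r = slope s).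
- exists ((f (a + 1) - f a) / (a + 1 - a)) => r [s [s0 [sa ->]]].
  by apply: ub => //; lra.
- by exists (slope 0), 0; repeat split; lra.
exists c; split=> [|y y0].
  have : slope 0 <= c by apply: cub; exists 0; repeat split; lra.
  have : 0 <= slope 0; last lra.
  apply: Rdiv_le_0_compat; last lra.
  by have := mono 0 a ltac:(lra) a0; lra.
case: (Rtotal_order y a) => [ya|[->|ya]]; last 1 first.
- have : c <= (f y - f a) / (y - a) by apply: club => r [s [s0 [sa ->]]]; exact: ub.
  move=> h; have := Rmult_le_compat_r (y - a) _ _ ltac:(lra) h.
  have -> : (f y - f a) / (y - a) * (y - a) = f y - f a by field; lra.
  lra.
- have : slope y <= c by apply: cub; exists y.
  move=> h; have := Rmult_le_compat_r (a - y) _ _ ltac:(lra) h.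
  rewrite slopeE //; lra.
- lra.
Qed.

Section HermiteHadamard.
Context {H : HilbertSpace}.
Hypothesis H_nonzero : exists x : H, x <> zero.
Implicit Types (x y z : H) (A S T P : Op H) (f : R -> R).

Lemma op_le_ip S T x : op_le S T -> ip (S x) x <= ip (T x) x.
Proof.
move=> /(_ x) [r [r0 e]]; have : ip (minus T S x) x = r by rewrite /ip e.
rewrite opE ipE; lra.
Qed.

Lemma symmetric_scalar r : symmetric (scal r op_one : Op H).
Proof. exact: symmetric_scal. Qed.

Lemma scalar_nonneg r : 0 <= r -> op_nonneg (scal r op_one : Op H).
Proof. by move=> r0 x; rewrite !opE ipE; apply: Rmult_le_pos => //; exact: ip_ge0. Qed.

Lemma operator_convex_ip f S T t x : operator_convex H (fun r => 0 <= r) f ->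
  symmetric S -> op_nonneg S -> symmetric T -> op_nonneg T -> 0 <= t <= 1 ->
  ip (cfc f (plus (scal (1 - t) S) (scal t T)) x) x <=
  (1 - t) * ip (cfc f S x) x + t * ip (cfc f T x) x.
Proof.
move=> [_ conv] sS pS sT pT t01.
have /(op_le_ip x) := conv S T (symmetric_selfadjoint sS) (symmetric_selfadjoint sT)
  (positive_spectrum_in sS pS) (positive_spectrum_in sT pT) t t01.
by rewrite !opE !ipE.
Qed.

Lemma cfc_scalar f r : cfc f (scal r op_one : Op H) = scal (f r) op_one.
Proof. by apply: (cfc_eq H_nonzero); [exact: symmetric_scalar | exact: cfc_const_op]. Qed.

(** Operator convexity tested on multiples of the identity, at a nonzero vector. *)
Lemma operator_convex_convex f : operator_convex H (fun r => 0 <= r) f ->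
  forall s r t, 0 <= s -> 0 <= r -> 0 <= t <= 1 ->
  f ((1 - t) * s + t * r) <= (1 - t) * f s + t * f r.
Proof.
move=> conv s r t s0 r0 t01; have [x xz] := H_nonzero.
have := operator_convex_ip x conv (symmetric_scalar s) (scalar_nonneg s0)
  (symmetric_scalar r) (scalar_nonneg r0) t01.
have -> : plus (scal (1 - t) (scal s op_one)) (scal t (scal r op_one)) =
    scal ((1 - t) * s + t * r) op_one :> Op H.
  by apply: op_ext => y; apply: ip_ext => h; rewrite !opE !ipE; ring.
rewrite !cfc_scalar !opE !ipE => h.
have x0 : 0 < ip x x.
  by case: (ip_ge0 x) => // e; case: xz; exact: ip_eq0.
apply: (Rmult_le_reg_r (ip x x)) => //; lra.
Qed.

Lemma cfc_jensen f T x (a : R) : operator_convex H (fun r => 0 <= r) f ->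
  (forall r s, 0 <= r -> r <= s -> f r <= f s) ->
  symmetric T -> op_nonneg T -> norm x = 1 -> 0 <= a -> a <= ip (T x) x ->
  f a <= ip (cfc f T x) x.
Proof.
move=> conv mono sT pT x1 a0 aT.
have [c [c0 hc]] := convex_support_line (operator_convex_convex conv) mono a0.
(* The list is the support line at [a]; since [c] is nonnegative, [a <= ip (T x) x] suffices in
   place of equality. *)
have := @is_cfc_lower_bound _ H_nonzero _ _ _ (f a - c * a :: c :: nil) sT
  (is_cfc_cfc H_nonzero (proj1 conv) sT pT) _ x.
rewrite !poly_op_cons poly_op_nil !opL !ipE ip_norm x1 => h.
have {}h := h _; have := Rmult_le_compat_l _ _ _ c0 aT.
have : (f a - c * a) * 1 ^ 2 + (c * ip (T x) x + 0) <= ip (cfc f T x) x; last lra.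
apply: h => r /(positive_spectrum sT pT) [r0 _] /=.
by have := hc r r0; lra.
Qed.

Lemma numerical_radius_sup A :
  (forall x, norm x = 1 -> Cmod (inner (A x) x) <= numerical_radius A) /\
  (forall e, 0 < e -> exists x, norm x = 1 /\ numerical_radius A - e < Cmod (inner (A x) x)).
Proof.
rewrite /numerical_radius.
set E := fun r : R => exists x : H, norm x = 1 /\ r = Cmod (inner (A x) x).
case: (Lub_Rbar_correct E); set L := Lub_Rbar E => ub lub.
have [x0 x01] : exists x : H, norm x = 1.
  have [x xz] := H_nonzero; exists (rscal (/ norm x) x).
  have n0 : 0 < norm x by case: (norm_ge_0 x) => // e; case: xz; exact: norm_eq_zero.
  rewrite norm_rscal Rabs_pos_eq; first by field; lra.
  by apply: Rlt_le; exact: Rinv_0_lt_compat.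
(* Finiteness matters because [real] sends infinite values to [0]. *)
have bK : Rbar_le L (norm (scal (/ 2) (plus (op_abs A) (op_abs (adjoint A))))).
  apply: lub => r [x [x1 ->]] /=; apply: Rle_trans (numerical_radius_bound H_nonzero A x) _.
  apply: Rle_trans (Rle_abs _) _; apply: Rle_trans (ip_op_bound _ _) _.
  by rewrite x1; right; ring.
have b0 : Rbar_le (Cmod (inner (A x0) x0)) L by apply: ub; exists x0.
move: bK b0 ub lub; case: L => [l| |] //= bK b0 ub lub; split.
- by move=> x x1; apply: (ub (Cmod (inner (A x) x))); exists x.
- move=> e e0; apply: NNPP => h; have : l <= l - e; last lra.
  apply: (lub (Finite (l - e))) => r [x [x1 ->]] /=.
  by apply: Rnot_lt_le => lt; apply: h; exists x.
Qed.

Lemma numerical_radius_ge0 A : 0 <= numerical_radius A.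
Proof.
have [_ h] := numerical_radius_sup A.
apply: Rnot_lt_le => lt; have [x [_ hx]] := h (- numerical_radius A) ltac:(lra).
rewrite Rminus_def Ropp_involutive in hx.
have [ub _] := numerical_radius_sup A.
by have [y [y1 _]] := h 1 ltac:(lra); have := ub y y1; have := Cmod_ge_0 (inner (A y) y); lra.
Qed.

Lemma numerical_radius_sqr_le f A (N : R) : continuous_on (fun r => 0 <= r) f ->
  (forall x, norm x = 1 -> f (Cmod (inner (A x) x) ^ 2) <= N) ->
  f (numerical_radius A ^ 2) <= N.
Proof.
move=> cf h; apply: le_epsilon => e e0.
have w0 := numerical_radius_ge0 A; have [ub near] := numerical_radius_sup A.
set w := numerical_radius A in w0 ub near *.
have w20 : 0 <= w ^ 2 by exact: pow2_ge_0.
have /filterlim_locally /(_ (mkposreal _ e0)) [d hd] := cf (w ^ 2) w20.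
have d0 := cond_pos d.
(* For [a <= w], [w^2 - a^2 = (w - a)(w + a)] is at most [(w - a)(2 w + 1)]; the [1] covers
   [w = 0]. *)
have k0 : 0 < d / (2 * w + 1) by apply: Rdiv_lt_0_compat; lra.
have [x [x1 hx]] := near _ k0; have := ub x x1; have := h x x1.
have := Cmod_ge_0 (inner (A x) x); set a := Cmod _ in hx * => a0 fa aw.
have b : Rabs (a ^ 2 - w ^ 2) < d.
  apply/Rabs_lt_between.
  have : (w - a) * (2 * w + 1) < d.
    have := Rmult_lt_compat_r (2 * w + 1) (w - a) (d / (2 * w + 1)) ltac:(lra) ltac:(lra).
    by have -> : d / (2 * w + 1) * (2 * w + 1) = d by field; lra.
  nra.
have /Rabs_lt_between : Rabs (f (a ^ 2) - f (w ^ 2)) < e := hd _ b (pow2_ge_0 a).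
lra.
Qed.

(** The norm bound [K] accompanies the Lipschitz constant [L] because the product rule in the
    induction consumes it. *)
Lemma poly_op_lipschitz (l : list R) (M : R) : 0 <= M -> exists K L, 0 <= K /\ 0 <= L /\
  forall S T, norm S <= M -> norm T <= M ->
    norm (poly_op l T) <= K /\
    norm (minus (poly_op l S) (poly_op l T)) <= L * norm (minus S T).
Proof.
move=> M0; elim: l => [|a l [K [L [K0 [L0 IH]]]]].
  exists 0, 0; split; first exact: Rle_refl.
  split=> [|S T _ _]; first exact: Rle_refl.
  by rewrite /= minus_eq_zero norm_zero Rmult_0_l; split; exact: Rle_refl.
exists (Rabs a + M * K), (M * L + K).
have MK := Rmult_le_pos _ _ M0 K0; have ML := Rmult_le_pos _ _ M0 L0.
split; first by have := Rabs_pos a; lra.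
split; first lra.
move=> S T SM TM; have [kT lST] := IH S T SM TM; split.
  apply: Rle_trans (norm_triangle _ _) _; apply: Rplus_le_compat.
    apply: op_norm_le => [|x]; first exact: Rabs_pos.
    by rewrite !opE norm_rscal; exact: Rle_refl.
  apply: Rle_trans (op_norm_mult _ _) _.
  by apply: Rmult_le_compat => //; exact: norm_ge_0.
have -> : minus (poly_op (a :: l) S) (poly_op (a :: l) T) =
    plus (mult S (minus (poly_op l S) (poly_op l T))) (mult (minus S T) (poly_op l T)).
  apply: op_ext => x; apply: ip_ext => h.
  by rewrite op_minusE !poly_op_cons op_plusE !op_multE !op_minusE !opL !ipE; ring.
apply: Rle_trans (norm_triangle _ _) _; rewrite Rmult_plus_distr_r.
apply: Rplus_le_compat; apply: Rle_trans (op_norm_mult _ _) _.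
  rewrite Rmult_assoc; apply: Rmult_le_compat => //; exact: norm_ge_0.
by rewrite Rmult_comm; apply: Rmult_le_compat_r => //; exact: norm_ge_0.
Qed.

(** One polynomial approximates [f] on [[0, M]], which contains all the spectra, hence uniformly
    along the path. *)
Lemma cfc_path_continuous f (T : R -> Op H) (M K : R) :
  continuous_on (fun r => 0 <= r) f -> 0 <= M -> 0 <= K ->
  (forall s, symmetric (T s)) -> (forall s, op_nonneg (T s)) ->
  (forall s, norm (T s) <= M) ->
  (forall s t, norm (minus (T s) (T t)) <= K * Rabs (s - t)) ->
  forall s, continuous (fun s => cfc f (T s)) s.
Proof.
move=> cf M0 K0 sT pT TM lipT t; apply/filterlim_locally => eps.
have ep := cond_pos eps; have e3 : 0 < eps / 4 by lra.
have [l hl] := weierstrass cf M0 e3.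
have [B [L [_ [L0 lip]]]] := poly_op_lipschitz l M0.
have KL : 0 <= L * K by exact: Rmult_le_pos.
have d0 : 0 < eps / 4 / (L * K + 1) by apply: Rdiv_lt_0_compat; lra.
exists (mkposreal _ d0) => s st.
have {}st : Rabs (s - t) < eps / 4 / (L * K + 1) by exact: st.
have near r : norm (minus (cfc f (T r)) (poly_op l (T r))) <= eps / 4.
  apply: (is_cfc_dist H_nonzero (sT r) _ (is_cfc_cfc H_nonzero cf (sT r) (pT r))); first lra.
  move=> q /(positive_spectrum (sT r) (pT r)) hq; apply: hl; have := TM r; lra.
have [_ h] := lip (T s) (T t) (TM s) (TM t).
have h1 : norm (minus (poly_op l (T s)) (poly_op l (T t))) <= eps / 4.
  apply: Rle_trans h _; apply: Rle_trans (Rmult_le_compat_l _ _ _ L0 (lipT s t)) _.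
  rewrite -Rmult_assoc.
  apply: Rle_trans (Rmult_le_compat_l _ _ _ KL (Rlt_le _ _ st)) _.
  apply: (Rle_trans _ ((L * K + 1) * (eps / 4 / (L * K + 1)))).
    by apply: Rmult_le_compat_r; lra.
  by right; field; lra.
have : norm (minus (cfc f (T s)) (cfc f (T t))) < eps; last by [].
have h2 := norm_minus_triangle (cfc f (T s)) (poly_op l (T s)) (cfc f (T t)).
have h3 := norm_minus_triangle (poly_op l (T s)) (poly_op l (T t)) (cfc f (T t)).
have h4 := near t; rewrite op_norm_minusC in h4.
have := near s; lra.
Qed.

Lemma ip_op_linear x : is_linear (fun A : Op H => ip (A x) x : R_NormedModule).
Proof.
split=> [A B|r A|].
- by rewrite opE ipE.
- by rewrite opE ipE.
- exists (norm x ^ 2 + 1); split=> [|A]; first by have := pow2_ge_0 (norm x); lra.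
  apply: Rle_trans (ip_op_bound A x) _; rewrite Rmult_comm.
  by apply: Rmult_le_compat_r; [exact: norm_ge_0 | lra].
Qed.

(** Lets the functional [A -> <Ax, x>] pass under the operator integral. *)
Lemma is_RInt_linear (V W : NormedModule R_AbsRing) (L : V -> W) (F : R -> V) (a b : R) (I : V) :
  is_linear L -> is_RInt F a b I -> is_RInt (fun s => L (F s)) a b (L I).
Proof.
move=> lL hF.
have sumL ptd : L (Riemann_sum F ptd) = Riemann_sum (fun s => L (F s)) ptd.
  apply: (SF_cons_ind (T := R) (fun ptd => L (Riemann_sum F ptd) =
    Riemann_sum (fun s => L (F s)) ptd)) => [x0|h s IH].
    by rewrite /Riemann_sum /=; exact: (linear_zero _ lL).
  by rewrite !Riemann_sum_cons (linear_plus _ lL) (linear_scal _ lL) IH.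
apply: (filterlim_ext (fun ptd => L (scal (sign (b - a)) (Riemann_sum F ptd)))).
  by move=> ptd; rewrite (linear_scal _ lL) sumL.
apply: (filterlim_comp _ _ _ _ L _ _ _ hF).
exact: linear_cont.
Qed.

End HermiteHadamard.

Theorem theorem3p7 (H : HilbertSpace) (H_nonzero : exists x : H, x <> zero)
    (A : Op H) (f : R -> R)
    (f_nonneg : forall x, 0 <= x -> 0 <= f x)
    (f_incr : forall x y, 0 <= x -> x <= y -> f x <= f y)
    (f_opconvex : operator_convex H (fun x => 0 <= x) f)
    (alpha : R) (alpha01 : 0 <= alpha <= 1) :
  let w2 := numerical_radius A ^ 2 in
  let X : Op H :=
    plus (scal alpha (pow_n (scal (/ 2) (plus (op_abs A) (op_abs (adjoint A)))) 2))
         (scal (1 - alpha) (pow_n (op_abs A) 2)) in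
  let F : R -> Op H :=
    fun t => cfc f (plus (scal (1 - t) X) (scal (t * w2) op_one)) in
  f w2 <= norm (RInt F 0 1) /\ norm (RInt F 0 1) <= norm (cfc f X).
Proof.
move=> w2 X F.
have cf := proj1 f_opconvex.
set K : Op H := scal (/ 2) (plus (op_abs A) (op_abs (adjoint A))) in X F *.
have sK : symmetric K.
  by apply: symmetric_scal; apply: symmetric_plus; exact: op_abs_symmetric.
have sB := op_abs_symmetric H_nonzero A.
(* Both squares become norms: [K] is symmetric, and the square of [op_abs A] is [adjoint A] times
   [A]. *)
have XE x : ip (X x) x = alpha * norm (K x) ^ 2 + (1 - alpha) * norm (A x) ^ 2.
  have -> : ip (X x) x =
    alpha * ip (K (K x)) x + (1 - alpha) * ip (op_abs A (op_abs A x)) x.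
    by rewrite -!ip_scal_l -ip_plus_l.
  by rewrite sK (op_abs_sqr H_nonzero) (ip_sym _ x) -adjoint_ip !ip_norm.
have sX : symmetric X.
  by apply: symmetric_plus; apply: symmetric_scal => x y; rewrite /= ?sK ?sB.
have pX : op_nonneg X.
  move=> x; rewrite XE.
  by apply: Rplus_le_le_0_compat; apply: Rmult_le_pos; try exact: pow2_ge_0; lra.
have w20 : 0 <= w2 by exact: pow2_ge_0.
have wX x : norm x = 1 -> Cmod (inner (A x) x) ^ 2 <= ip (X x) x.
  move=> x1; rewrite XE.
  have c0 := Cmod_ge_0 (inner (A x) x).
  have hK : Cmod (inner (A x) x) <= norm (K x).
    apply: Rle_trans (numerical_radius_bound H_nonzero A x) _.
    by apply: Rle_trans (ip_le_norm _ _) _; rewrite x1 Rmult_1_r; exact: Rle_refl.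
  have hA : Cmod (inner (A x) x) <= norm (A x).
    by have := Cmod_inner_le (A x) x; rewrite x1 Rmult_1_r.
  have := Rmult_le_compat_l alpha _ _ ltac:(lra) (pow_incr _ _ 2 (conj c0 hK)).
  have := Rmult_le_compat_l (1 - alpha) _ _ ltac:(lra) (pow_incr _ _ 2 (conj c0 hA)).
  lra.
have wx x : norm x = 1 -> Cmod (inner (A x) x) ^ 2 <= w2.
  move=> x1; apply: pow_incr; split; first exact: Cmod_ge_0.
  exact: (proj1 (numerical_radius_sup H_nonzero A)).
have fX : f w2 <= norm (cfc f X).
  apply: numerical_radius_sqr_le => // x x1.
  apply: Rle_trans (cfc_jensen H_nonzero f_opconvex f_incr sX pX x1 (pow2_ge_0 _) (wX x x1)) _.
  apply: Rle_trans (Rle_abs _) _; apply: Rle_trans (ip_op_bound _ _) _.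
  by rewrite x1; right; ring.
pose T t : Op H := plus (scal (1 - t) X) (scal (t * w2) op_one).
have sT t : symmetric (T t).
  by apply: symmetric_plus; [exact: symmetric_scal | exact: symmetric_scalar].
have TE t x : ip (T t x) x = (1 - t) * ip (X x) x + t * w2 * ip x x.
  by rewrite -!ip_scal_l -ip_plus_l.
have pT t : 0 <= t <= 1 -> op_nonneg (T t).
  move=> t01 x; rewrite TE; have := pX x; have := ip_ge0 x => i0 x0.
  apply: Rplus_le_le_0_compat; first by apply: Rmult_le_pos; lra.
  by apply: Rmult_le_pos => //; apply: Rmult_le_pos; lra.
have Flow t x : 0 <= t <= 1 -> norm x = 1 ->
    f (Cmod (inner (A x) x) ^ 2) <= ip (F t x) x.
  move=> t01 x1; apply: (cfc_jensen H_nonzero f_opconvex f_incr (sT t) (pT t t01) x1 (pow2_ge_0 _)).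
  rewrite TE ip_norm x1.
  have := Rmult_le_compat_l (1 - t) _ _ ltac:(lra) (wX x x1).
  have := Rmult_le_compat_l t _ _ ltac:(lra) (wx x x1).
  lra.
have FN t : 0 <= t <= 1 -> norm (F t) <= norm (cfc f X).
  move=> t01; have cT := is_cfc_cfc H_nonzero cf (sT t) (pT t t01).
  apply: symmetric_norm_le; [exact: is_cfc_symmetric (sT t) cT | exact: norm_ge_0 |] => x.
  have Fx0 : 0 <= ip (F t x) x.
    have := @is_cfc_lower_bound _ H_nonzero _ _ _ nil (sT t) cT _ x.
    rewrite poly_op_nil ip_zero_l; apply=> r /(positive_spectrum (sT t) (pT t t01)) [r0 _].
    exact: f_nonneg.
  rewrite Rabs_pos_eq //.
  have := operator_convex_ip x f_opconvex sX pX
    (symmetric_scalar w2) (scalar_nonneg w20) t01.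
  rewrite (cfc_scalar H_nonzero).
  have -> : plus (scal (1 - t) X) (scal t (scal w2 op_one)) = T t.
    by rewrite /T scal_assoc.
  rewrite -/(F t) [scal (f w2) op_one x]op_scalE op_one'E ip_scal_l.
  have /Rabs_le_between [_] := ip_op_bound (cfc f X) x; rewrite -ip_norm => h1.
  have h2 := Rmult_le_compat_r _ _ _ (ip_ge0 x) fX.
  have h3 := Rmult_le_compat_l (1 - t) _ _ ltac:(lra) h1.
  have h4 := Rmult_le_compat_l t _ _ ltac:(lra) h2.
  lra.
(* [F] is only meaningful on [0, 1], so continuity is proved for [F] composed
   with the projection of the line onto [0, 1]. *)
pose clamp s := Rmax 0 (Rmin 1 s).
have clamp01 s : 0 <= clamp s <= 1.
  by rewrite /clamp; split; [exact: Rmax_l | apply: Rmax_lub; [lra | exact: Rmin_l]].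
have clampE s : 0 <= s <= 1 -> clamp s = s.
  by move=> s01; rewrite /clamp Rmin_right; [rewrite Rmax_right; lra | lra].
have clamp_lip s t : Rabs (clamp s - clamp t) <= Rabs (s - t).
  by apply: Rle_trans (Rmax_lipschitz _ _ _) _; exact: Rmin_lipschitz.
have iF : is_RInt F 0 1 (RInt F 0 1).
  apply: RInt_correct; apply: (ex_RInt_ext (fun s => F (clamp s))).
    move=> s; rewrite Rmin_left; last lra.
    by rewrite Rmax_right; last lra; move=> hs; rewrite clampE //; lra.
  apply: ex_RInt_continuous => s _.
  have nX := norm_ge_0 X.
  have n1 : norm (op_one : Op H) <= 1.
    by apply: op_norm_le => [|x]; [lra | rewrite Rmult_1_l; exact: Rle_refl].
  (* [norm X + w2] bounds both the norms and the Lipschitz constant, [T] being affine with slope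
     [w2 - X]. *)
  apply: (@cfc_path_continuous _ H_nonzero f (fun s => T (clamp s)) 
    (norm X + w2) (norm X + w2)) => //; try lra.
  - by move=> t; exact: pT.
  - move=> t; have [c0 c1] := clamp01 t.
    apply: Rle_trans (norm_triangle _ _) _.
    have n2 := op_norm_scal (1 - clamp t) X.
    have n3 := op_norm_scal (clamp t * w2) (op_one : Op H).
    rewrite Rabs_pos_eq in n2; last lra.
    rewrite Rabs_pos_eq in n3; last by apply: Rmult_le_pos.
    have m2 : (1 - clamp t) * norm X <= 1 * norm X by apply: Rmult_le_compat_r; lra.
    have m3 : clamp t * w2 * norm (op_one : Op H) <= 1 * w2 * 1.
      by apply: Rmult_le_compat => //; [exact: Rmult_le_pos | exact: norm_ge_0 |
        apply: Rmult_le_compat_r].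
    apply: Rle_trans (Rplus_le_compat _ _ _ _ n2 n3) _.
    apply: Rle_trans (Rplus_le_compat _ _ _ _ m2 m3) _; lra.
  - move=> r t.
    have -> : minus (T (clamp r)) (T (clamp t)) =
        scal (clamp r - clamp t) (minus (scal w2 op_one) X).
      apply: op_ext => x; apply: ip_ext => h.
      rewrite op_minusE /T !op_plusE !op_scalE op_minusE op_scalE op_one'E !ipE; ring.
    apply: Rle_trans (op_norm_scal _ _) _; rewrite Rmult_comm.
    apply: Rmult_le_compat (op_norm_ge0 _) (Rabs_pos _) _ (clamp_lip r t).
    apply: Rle_trans (op_norm_triangle _ _) _; rewrite op_norm_opp Rplus_comm.
    apply: Rplus_le_compat_l; apply: Rle_trans (op_norm_scal _ _) _.
    rewrite Rabs_pos_eq //; apply: (Rle_trans _ (w2 * 1)); last lra.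
    exact: Rmult_le_compat_l.
split; last first.
  have h := norm_RInt_le_const _ _ _ _ _ (Rlt_le _ _ Rlt_0_1) FN iF.
  by rewrite Rminus_0_r Rmult_1_l in h.
apply: numerical_radius_sqr_le => // x x1.
have := is_RInt_linear (ip_op_linear x) iF => iFx.
have c := @is_RInt_const R_NormedModule 0 1 (f (Cmod (inner (A x) x) ^ 2)).
have low t : 0 < t < 1 -> f (Cmod (inner (A x) x) ^ 2) <= ip (F t x) x.
  by move=> t01; apply: Flow => //; lra.
have := is_RInt_le _ _ _ _ _ _ (Rlt_le _ _ Rlt_0_1) c iFx low.
rewrite /scal /= /mult /= => h.
apply: (Rle_trans _ (ip (RInt F 0 1 x) x)).
  by rewrite Rminus_0_r Rmult_1_l in h.
apply: Rle_trans (Rle_abs _) _; apply: Rle_trans (ip_op_bound _ _) _.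
by rewrite x1 pow1 Rmult_1_r; exact: Rle_refl.
Qed.
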